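(* Let $X$ be a complex manifold and $E\to X$ a holomorphic vector bundle. The model $(X,E)$ is good if and only if, for every integer $k\geq 2$, taking global sections preserves exactness of the short exact sequence of sheaves of groups $$\{e\}\longrightarrow \mathcal G^{(k+1)}_{(X,E)}\longrightarrow \mathcal G^{(k)}_{(X,E)}\longrightarrow \mathcal Q^{(k)}_{(X,E)}\longrightarrow\{e\},$$ i.e. if and only if for every $k\ge 2$ the sequence $\{e\}\to H^0(X,\mathcal G^{(k+1)}_{(X,E)})\to H^0(X,\mathcal G^{(k)}_{(X,E)})\to H^0(X,\mathcal Q^{(k)}_{(X,E)})\to\{e\}$ is exact.
   Context: A model is a pair $(X,E)$ with $X$ a complex manifold and $E\to X$ a holomorphic vector bundle; $\mathcal E$ is its sheaf of holomorphic sections, $\wedge^\bullet\mathcal E$ the sheaf of exterior algebras, regarded as a sheaf of $\mathbb Z_2$-graded supercommutative $\mathbb C$-algebras, and $\mathcal{A}ut\,\wedge^\bullet\mathcal E$ the sheaf of its $\mathbb Z_2$-grading-preserving algebra automorphisms. Let $\mathcal J_{(X,E)}=\bigoplus_{j>0}\wedge^j\mathcal E$ be the ideal generated by $\mathcal E$. For $k\ge 2$ set $\mathcal G^{(k)}_{(X,E)}=\{\alpha\in \mathcal{A}ut\,\wedge^\bullet\mathcal E \mid \alpha(u)-u\in\mathcal J^k_{(X,E)}\text{ for all local sections }u\}$. It is known (Green) that $\mathcal G^{(k+1)}_{(X,E)}$ is a normal subsheaf of $\mathcal G^{(k)}_{(X,E)}$ with abelian quotient $\mathcal Q^{(k)}_{(X,E)}=\mathcal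 G^{(k)}_{(X,E)}/\mathcal G^{(k+1)}_{(X,E)}$, called the $k$-th obstruction sheaf. For a sheaf of groups $G$, $\check H^1(X,G)$ is the pointed Čech cohomology set, with basepoint (denoted $\{e\}$) the class of the trivial cocycle. A supermanifold modelled on $(X,E)$ is an element of $\check H^1(X,\mathcal G^{(2)}_{(X,E)})$. For $k\ge 2$, a $(k-1)$-split atlas is an element $\mathfrak X^{(k)}$ of $\check H^1(X,\mathcal G^{(k)}_{(X,E)})$; its associated supermanifold is its image in $\check H^1(X,\mathcal G^{(2)}_{(X,E)})$ under the map induced by inclusion. Its primary obstruction is its image in $H^1(X,\mathcal Q^{(k)}_{(X,E)})$ under the map induced by the quotient; $\mathfrak X^{(k)}$ is obstructed if its primary obstruction is nonzero. For $k>2$, $\mathfrak X^{(k)}$ is strongly split if its associated supermanifold is the basepoint, and is exotic if it is both obstructed and strongly split. The model $(X,E)$ is good if there are no exotic atlases (for any $k>2$) for any supermanifold modelled on $(X,E)$. *)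

(* Defs.v *)
From HB Require Import structures.
From mathcomp Require Import all_boot all_order all_algebra.

Set Implicit Arguments.
Unset Strict Implicit.
Unset Printing Implicit Defensive.

Import GRing.Theory Num.Theory.
Local Open Scope ring_scope.

(* The exterior algebra of K^n: [v S] is the coefficient of v on the basis    *)
(* element e_S = e_{i_1} /\ ... /\ e_{i_j}, S = {i_1 < ... < i_j}, and        *)
(* e_S /\ e_T = (-1)^(ext_inv S T) e_(S u T) if S, T are disjoint, 0 if not.  *)
Definition ext (K : fieldType) (n : nat) := {ffun {set 'I_n} -> K^o}.

HB.instance Definition _ (K : fieldType) n := GRing.Lmodule.on (ext K n).

Definition ext_inv n (S T : {set 'I_n}) : nat :=
  #|[set p in finset.setX S T | (p.2 < p.1)%N]|.

Section ExteriorAlgebra.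
Variables (K : fieldType) (n : nat).
Implicit Types (S T P Q : {set 'I_n}) (u v w : ext K n).

Definition ext_one : ext K n := [ffun S : {set 'I_n} => (S == finset.set0)%:R].

Definition ext_mul u v : ext K n :=
  [ffun S : {set 'I_n} => \sum_(T : {set 'I_n} | T \subset S)
     (-1) ^+ ext_inv T (S :\: T) * (u T * v (S :\: T))].

Lemma ext_invUl S T Q : [disjoint S & T] ->
  ext_inv (S :|: T) Q = (ext_inv S Q + ext_inv T Q)%N.
Proof.
move=> dST; rewrite /ext_inv.
have -> : [set p in finset.setX (S :|: T) Q | (p.2 < p.1)%N] =
  [set p in finset.setX S Q | (p.2 < p.1)%N] :|:
  [set p in finset.setX T Q | (p.2 < p.1)%N].
  by apply/setP => -[a b]; rewrite !inE -andb_orl -andb_orl.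
rewrite cardsU [X in (_ - X)%N](_ : _ = 0%N) ?subn0 //.
apply/eqP; rewrite cards_eq0 -subset0; apply/subsetP => -[a b].
rewrite !inE /= => /andP[/andP[/andP[aS _] _] /andP[/andP[aT _] _]].
by move/disjointFr : dST => /(_ _ aS); rewrite aT.
Qed.

Lemma ext_invUr S T Q : [disjoint S & T] ->
  ext_inv Q (S :|: T) = (ext_inv Q S + ext_inv Q T)%N.
Proof.
move=> dST; rewrite /ext_inv.
have -> : [set p in finset.setX Q (S :|: T) | (p.2 < p.1)%N] =
  [set p in finset.setX Q S | (p.2 < p.1)%N] :|:
  [set p in finset.setX Q T | (p.2 < p.1)%N].
  by apply/setP => -[a b]; rewrite !inE -andb_orl -andb_orr.
rewrite cardsU [X in (_ - X)%N](_ : _ = 0%N) ?subn0 //.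
apply/eqP; rewrite cards_eq0 -subset0; apply/subsetP => -[a b].
rewrite !inE /= => /andP[/andP[/andP[_ aS] _] /andP[/andP[_ aT] _]].
by move/disjointFr : dST => /(_ _ aS); rewrite aT.
Qed.

Fact ext_mulA_subproof (a b c x y z : K) :
  a * b * (x * (c * (y * z))) = b * c * (a * (x * y) * z).
Proof. by rewrite -!mulrA mulrCA (mulrCA x) (mulrCA a). Qed.

Lemma ext_mulA : associative ext_mul.
Proof.
move=> u v w; apply/ffunP => S; rewrite !ffunE.
under eq_bigr => T _ do rewrite ffunE big_distrr big_distrr /=.
under [RHS]eq_bigr => T _ do rewrite ffunE big_distrl big_distrr /=.
rewrite [RHS](exchange_big_dep (fun T : {set 'I_n} => T \subset S)) /=; last first.
  by move=> P T PS TP; apply: subset_trans PS.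
apply: eq_bigr => T TS.
rewrite [RHS](reindex_onto (fun Q : {set 'I_n} => T :|: Q) (fun P => P :\: T)) /=; last first.
  by move=> P; case/andP=> [_ TP]; apply/setP => i; rewrite !inE; case iT: (i \in T) => //=; rewrite (subsetP TP).
have E Q : (Q \subset S :\: T) =
   (T :|: Q \subset S) && (T \subset T :|: Q) && ((T :|: Q) :\: T == Q).
  rewrite subsetD finset.subsetUl finset.subUset TS /= andbT.
  case: (Q \subset S) => //=.
  rewrite finset.setDUl finset.setDv finset.set0U.
  by rewrite -(sameP setDidPl eqP).
apply: eq_big => Q; rewrite ?E //.
rewrite -E subsetD => /andP[QS dQT].
have -> : (T :|: Q) :\: T = Q.
  by rewrite finset.setDUl finset.setDv finset.set0U; apply/setDidPl.
rewrite finset.setDDl.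
have SE : S :\: T = Q :|: (S :\: (T :|: Q)).
  apply/setP => i; rewrite !inE; case iQ: (i \in Q) => /=.
    by rewrite (disjointFr dQT iQ) (subsetP QS _ iQ).
  by rewrite orbF.
rewrite SE ext_invUr ?ext_invUl //.
    by rewrite !exprD; exact: ext_mulA_subproof.
  by rewrite disjoint_sym.
apply/pred0P => i /=; rewrite !inE; case: (i \in Q); rewrite ?orbT ?andbF //=.
Qed.

Lemma ext_mul1l : left_id ext_one ext_mul.
Proof.
move=> u; apply/ffunP => S; rewrite ffunE (bigD1 finset.set0) ?finset.sub0set //=.
rewrite finset.setD0 [ext_inv _ _]eq_card0 ?expr0 ?mul1r; last first.
  by case=> a b; rewrite !inE.
rewrite ffunE eqxx mul1r big1 ?addr0 // => T /andP[_ /negPf T0].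
by rewrite ffunE T0 mul0r mulr0.
Qed.

Lemma ext_mul1r : right_id ext_one ext_mul.
Proof.
move=> u; apply/ffunP => S; rewrite ffunE (bigD1 S) //=.
rewrite finset.setDv [ext_inv _ _]eq_card0 ?expr0 ?mul1r; last first.
  by case=> a b; rewrite !inE andbF.
rewrite ffunE eqxx mulr1 big1 ?addr0 // => T /andP[TS TneS].
rewrite ffunE (_ : S :\: T == finset.set0 = false) ?mulr0 //.
by apply/negbTE; rewrite finset.setD_eq0; move: TneS; rewrite eqEsubset TS.
Qed.

Lemma ext_mulDl : left_distributive ext_mul +%R.
Proof.
move=> u v w; apply/ffunP => S; rewrite !ffunE -big_split /=.
by apply: eq_bigr => T _; rewrite ffunE mulrDl mulrDr.
Qed.

Lemma ext_mulDr : right_distributive ext_mul +%R.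
Proof.
move=> u v w; apply/ffunP => S; rewrite !ffunE -big_split /=.
by apply: eq_bigr => T _; rewrite ffunE mulrDr mulrDr.
Qed.

Lemma ext_one_neq0 : ext_one != 0.
Proof.
apply/eqP => /ffunP/(_ finset.set0); rewrite !ffunE eqxx => /eqP.
by rewrite oner_eq0.
Qed.

HB.instance Definition _ := GRing.Zmodule_isNzRing.Build (ext K n)
  ext_mulA ext_mul1l ext_mul1r ext_mulDl ext_mulDr ext_one_neq0.

Lemma ext_scaleAl (a : K) (u v : ext K n) : a *: (u * v) = a *: u * v.
Proof.
apply/ffunP => S; rewrite !ffunE scaler_sumr; apply: eq_bigr => T _.
have E (s x y : K) : a * (s * (x * y)) = s * (a * x * y).
  by rewrite mulrCA -!mulrA.
by rewrite ffunE; exact: E.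
Qed.

HB.instance Definition _ :=
  GRing.LSemiModule_isLSemiAlgebra.Build K (ext K n) ext_scaleAl.

Lemma ext_scaleAr (a : K) (u v : ext K n) : a *: (u * v) = u * (a *: v).
Proof.
apply/ffunP => S; rewrite !ffunE scaler_sumr; apply: eq_bigr => T _.
have E (s x y : K) : a * (s * (x * y)) = s * (x * (a * y)).
  by rewrite mulrCA (mulrCA a).
by rewrite ffunE; exact: E.
Qed.

HB.instance Definition _ :=
  GRing.LSemiAlgebra_isSemiAlgebra.Build K (ext K n) ext_scaleAr.

End ExteriorAlgebra.

Section ExteriorGrading.
Variables (K : fieldType) (n : nat).
Implicit Types (P : pred nat) (u v w : ext K n).

(* u lies in the direct sum of the \wedge^j K^n, j \in P *)
Definition ext_in P u := forall S, u S != 0 -> P #|S|.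

Lemma ext_inM a b u v :
  ext_in (leq a) u -> ext_in (leq b) v -> ext_in (leq (a + b)) (u * v).
Proof.
move=> ua vb S; apply: contraR; rewrite -ltnNge => Sab.
rewrite ffunE big1 // => T TS.
have [aT|Ta] := leqP a #|T|.
  have /eqP -> : v (S :\: T)%SET == 0; last by rewrite !mulr0.
  apply: contraTT Sab => /vb bST.
  by rewrite -leqNgt -(cardsID T S) (setIidPr TS) leq_add.
have /eqP -> : u T == 0; last by rewrite mul0r mulr0.
by apply: contraTT Ta => /ua; rewrite -leqNgt.
Qed.

Lemma ext_in_nilp u : ext_in (leq 1) u -> u ^+ n.+1 = 0.
Proof.
move=> u1; have H k : ext_in (leq k) (u ^+ k).
  elim: k => [|k IH]; first by move=> S.
  by rewrite exprS -add1n; apply: ext_inM.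
apply/ffunP => S; rewrite ffunE; apply/eqP; apply: contraT => /(H n.+1 S).
by rewrite ltnNge -[X in (_ <= X)%N](card_ord n) max_card.
Qed.

Lemma ext_mul0 u v : (u * v) finset.set0 = u finset.set0 * v finset.set0.
Proof.
rewrite ffunE (bigD1 finset.set0) ?finset.sub0set //= big1 => [|T]; last first.
  by rewrite finset.subset0 => /andP[->].
rewrite finset.setD0 [ext_inv _ _]eq_card0 ?expr0 ?mul1r ?addr0 //.
by case=> a b; rewrite !inE.
Qed.

Lemma ext_in1P u : ext_in (leq 1) u <-> u finset.set0 = 0.
Proof.
split=> [u1|u0 S].
  by apply/eqP; apply: contraT => /u1; rewrite cards0.
by rewrite card_gt0; apply: contraNneq => ->; rewrite u0.
Qed.
End ExteriorGrading.

(* The exterior algebra of a vector space, built on the chosen basis of V.    *)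
Definition extalg (K : fieldType) (V : vectType K) := ext K (\dim {:V}).
HB.instance Definition _ (K : fieldType) (V : vectType K) :=
  GRing.Algebra.on (extalg V).

(* The inclusion of V = \wedge^1 V *)
Definition ext_vec (K : fieldType) (V : vectType K) (v : V) : extalg V :=
  [ffun S : {set 'I_(\dim {:V})} =>
     \sum_i coord (vbasis {:V}) i v *+ (S == [set i]%SET)].

From mathcomp Require Import boolp classical_sets.
From mathcomp Require Import reals topology normedtype derive.
From mathcomp Require Import complex.
Import numFieldNormedType.Exports.

Local Open Scope classical_set_scope.
Local Open Scope ring_scope.

Section Opens.
Variable X : topologicalType.

Record opens := Opens { oset :> set X; oset_open : open oset }.

Lemma oinP (U V : opens) : open (U `&` V).
Proof. by apply: openI; apply: oset_open. Qed.

Definition oin (U V : opens) := Opens (oinP U V).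
Lemma oinl (U V : opens) : oin U V `<=` U. Proof. by move=> x []. Qed.
Lemma oinr (U V : opens) : oin U V `<=` V. Proof. by move=> x []. Qed.

Definition ofull := Opens (@openT X).

Definition open_cover (I : Type) (U : I -> opens) := forall x, exists i, oset (U i) x.
End Opens.

(* The sheaf axioms are not part of the record: H^0 and H^1 below only use    *)
(* the restriction maps.                                                      *)
Record grp_presheaf (X : topologicalType) := GrpPresheaf {
  psec :> opens X -> groupType;
  pres : forall U V : opens X, V `<=` U -> psec U -> psec V;
  presM : forall (U V : opens X) (h : V `<=` U) s t,
    pres h (s * t)%g = (pres h s * pres h t)%g;
  pres_id : forall (U : opens X) (h : U `<=` U) s, pres h s = s;
  pres_comp : forall (U V W : opens X) (h : V `<=` U) (k : W `<=` V) (l : W `<=` U) s,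
    pres k (pres h s) = pres l s }.
Arguments pres {X} g {U V}.

Record grp_morph (X : topologicalType) (F G : grp_presheaf X) := GrpMorph {
  pmor :> forall U, F U -> G U;
  pmorM : forall (U : opens X) (s t : F U),
    pmor (s * t)%g = (pmor s * pmor t)%g;
  pmor_res : forall (U V : opens X) (h : V `<=` U) (s : F U),
    pmor (pres F h s) = pres G h (pmor s) }.
Arguments pmor {X F G} g U s.

Section PresheafTheory.
Variable X : topologicalType.
Implicit Types (F G : grp_presheaf X).

Lemma pres1 F (U V : opens X) (h : V `<=` U) : pres F h 1%g = 1%g.
Proof. by apply: (mulgI (pres F h 1%g)); rewrite -presM !mulg1. Qed.

Lemma presV F (U V : opens X) (h : V `<=` U) s : pres F h s^-1%g = (pres F h s)^-1%g.
Proof. by apply: (mulgI (pres F h s)); rewrite -presM !mulgV pres1. Qed.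

Lemma pmor1 F G (f : grp_morph F G) U : f U 1%g = 1%g.
Proof. by apply: (mulgI (f U 1%g)); rewrite -pmorM !mulg1. Qed.

Lemma pmorV F G (f : grp_morph F G) U s : f U s^-1%g = (f U s)^-1%g.
Proof. by apply: (mulgI (f U s)); rewrite -pmorM !mulgV pmor1. Qed.
End PresheafTheory.

(* Cech cohomology: 1-cocycles over open covers, two of them being identified *)
(* when they become cohomologous on a common refinement. An open cover is a   *)
(* set of open subsets of X, indexed by itself: quantifying over index types  *)
(* instead would put H1 in a universe too large for covers indexed by X.      *)
Section CechH1.
Variables (X : topologicalType) (F : grp_presheaf X).

Record cocycle := Cocycle {
  ccover : set (opens X);
  ccov_cover : open_cover (fun i : {U | ccover U} => sval i);
  csec : forall i j : {U | ccover U}, F (oin (sval i) (sval j));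
  cocycleP : forall (i j k : {U | ccover U}) (W : opens X)
      (hij : W `<=` oin (sval i) (sval j)) (hjk : W `<=` oin (sval j) (sval k))
      (hik : W `<=` oin (sval i) (sval k)),
    (pres F hij (csec i j) * pres F hjk (csec j k) = pres F hik (csec i k))%g }.

Definition cidx (c : cocycle) := {U | ccover c U}.
Definition ccov (c : cocycle) (i : cidx c) : opens X := sval i.

HB.instance Definition _ := gen_eqMixin cocycle.
HB.instance Definition _ := gen_choiceMixin cocycle.

Definition cohomologous (c d : cocycle) : Prop :=
  exists (K : Type) (W : K -> opens X) (a : K -> cidx c) (b : K -> cidx d)
    (t : forall k, F (W k)),
  [/\ open_cover W,
      forall k, W k `<=` ccov (a k),
      forall k, W k `<=` ccov (b k) &
      forall k l (V : opens X) (hk : V `<=` W k) (hl : V `<=` W l)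
        (ha : V `<=` oin (ccov (a k)) (ccov (a l)))
        (hb : V `<=` oin (ccov (b k)) (ccov (b l))),
      (pres F hk (t k) * pres F ha (csec (a k) (a l)) =
       pres F hb (csec (b k) (b l)) * pres F hl (t l))%g].

Lemma cohomologous_refl c : cohomologous c c.
Proof.
exists (cidx c), (@ccov c), id, id, (fun=> 1%g).
split=> [|k x|k x|k l V hk hl ha hb] //; first exact: ccov_cover.
rewrite !pres1 mul1g mulg1.
by rewrite (Prop_irrelevance ha hb).
Qed.

Lemma cohomologous_sym c d : cohomologous c d -> cohomologous d c.
Proof.
move=> [K [W [a [b [t [cW ha hb ht]]]]]].
exists K, W, b, a, (fun k => (t k)^-1)%g; split => // k l V hk hl h1 h2.
rewrite !presV; apply: (mulgI (pres F hk (t k))); rewrite !mulgA mulgV mul1g.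
by rewrite (ht _ _ _ hk hl h2 h1) mulgK.
Qed.

Lemma cohomologous_trans c d e :
  cohomologous c d -> cohomologous d e -> cohomologous c e.
Proof.
move=> [K [W [a [b [t [cW ha hb ht]]]]]] [L [W' [b' [f [u [cW' hb' hf hu]]]]]].
have subW p : oin (W p.1) (W' p.2) `<=` W p.1 by move=> x [].
have subW' p : oin (W p.1) (W' p.2) `<=` W' p.2 by move=> x [].
have subd p : oin (W p.1) (W' p.2) `<=` oin (ccov (b' p.2)) (ccov (b p.1)).
  by move=> x [/hb ? /hb' ?].
exists (K * L)%type, (fun p => oin (W p.1) (W' p.2)), (fun p => a p.1),
  (fun p => f p.2), (fun p => pres F (subW' p) (u p.2) *
     pres F (subd p) (csec (b' p.2) (b p.1)) * pres F (subW p) (t p.1))%g.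
split => [x|k|l|[k l] [k' l'] V hk hl h1 h2].
- by have [k Wk] := cW x; have [l Wl] := cW' x; exists (k, l).
- exact: subset_trans (subW k) (ha k.1).
- exact: subset_trans (subW' l) (hf l.2).
have s1 : V `<=` W k by apply: subset_trans hk (subW (k, l)).
have s2 : V `<=` W k' by apply: subset_trans hl (subW (k', l')).
have s3 : V `<=` W' l by apply: subset_trans hk (subW' (k, l)).
have s4 : V `<=` W' l' by apply: subset_trans hl (subW' (k', l')).
have b1 : V `<=` ccov (b k) by apply: subset_trans s1 (hb k).
have b2 : V `<=` ccov (b k') by apply: subset_trans s2 (hb k').
have b3 : V `<=` ccov (b' l) by apply: subset_trans s3 (hb' l).
have b4 : V `<=` ccov (b' l') by apply: subset_trans s4 (hb' l').
have d1 : V `<=` oin (ccov (b' l)) (ccov (b k)) by move=> x Vx; split; auto.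
have d2 : V `<=` oin (ccov (b' l')) (ccov (b k')) by move=> x Vx; split; auto.
have d3 : V `<=` oin (ccov (b k)) (ccov (b k')) by move=> x Vx; split; auto.
have d4 : V `<=` oin (ccov (b' l)) (ccov (b k')) by move=> x Vx; split; auto.
have d5 : V `<=` oin (ccov (b' l)) (ccov (b' l')) by move=> x Vx; split; auto.
rewrite !presM (pres_comp _ _ s3) (pres_comp _ _ d1) (pres_comp _ _ s1).
rewrite (pres_comp _ _ s4) (pres_comp _ _ d2) (pres_comp _ _ s2) /=.
rewrite -!mulgA (ht _ _ _ s1 s2 h1 d3).
rewrite (mulgA (pres F d1 _)) (cocycleP d1 d3 d4).
rewrite -(cocycleP d5 d2 d4) !mulgA; do 2 congr (_ * _)%g.
exact: hu.
Qed.

Definition cohomb : rel cocycle := fun c d => `[< cohomologous c d >].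

Lemma cohomb_equiv : equiv_class_of cohomb.
Proof.
split=> [c|c d|d c e].
- by apply/asboolP; exact: cohomologous_refl.
- by apply/asboolP/asboolP; exact: cohomologous_sym.
- move=> /asboolP cd /asboolP de; apply/asboolP.
  exact: cohomologous_trans cd de.
Qed.

Canonical cohomb_equiv_rel := EquivRelPack cohomb_equiv.

Definition H1 := {eq_quot cohomb}%qT.

Lemma triv_cover :
  open_cover (fun i : {U : opens X | U = ofull X} => sval i).
Proof. by move=> x; exists (exist (fun U => U = ofull X) (ofull X) erefl). Qed.

Lemma triv_cocycleP (i j k : {U : opens X | U = ofull X}) (W : opens X)
    (hij : W `<=` oin (sval i) (sval j)) (hjk : W `<=` oin (sval j) (sval k))
    (hik : W `<=` oin (sval i) (sval k)) :
  (pres F hij 1 * pres F hjk 1 = pres F hik 1)%g.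
Proof. by rewrite !pres1 mulg1. Qed.

Definition triv_cocycle := @Cocycle [set U | U = ofull X] triv_cover
  (fun _ _ => 1%g) triv_cocycleP.

(* the basepoint {e} *)
Definition H1pt : H1 := \pi_H1%qT triv_cocycle.
End CechH1.

Section CechMap.
Variables (X : topologicalType) (F G : grp_presheaf X) (f : grp_morph F G).

Lemma cocycle_mapP (c : cocycle F) (i j k : cidx c) (W : opens X)
    (hij : W `<=` oin (sval i) (sval j)) (hjk : W `<=` oin (sval j) (sval k))
    (hik : W `<=` oin (sval i) (sval k)) :
  (pres G hij (f _ (csec i j)) * pres G hjk (f _ (csec j k)) =
   pres G hik (f _ (csec i k)))%g.
Proof. by rewrite -!pmor_res -pmorM cocycleP. Qed.

Definition cocycle_map (c : cocycle F) : cocycle G :=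
  Cocycle (@ccov_cover _ _ c) (@cocycle_mapP c).

Definition H1map (x : H1 F) : H1 G := \pi_(H1 G)%qT (cocycle_map (repr x)).

Lemma H1map_pi c : H1map (\pi_(H1 F)%qT c) = \pi_(H1 G)%qT (cocycle_map c).
Proof.
rewrite /H1map; case: piP => d /eqmodP/asboolP.
move=> [K [W [a [b [t [cW ha hb ht]]]]]]; apply/esym/eqmodP/asboolP.
exists K, W, a, b, (fun k => f _ (t k)); split => // k l V hk hl h1 h2 /=.
by rewrite -!pmor_res -!pmorM ht.
Qed.
End CechMap.

(* The quotient sheaf G / H of G by a normal subsheaf H: its stalk at x is    *)
(* G_x / H_x, and its sections are the families of elements of the stalks     *)
(* that are locally induced by sections of G.                                 *)
Record normal_sub (X : topologicalType) (H G : grp_presheaf X) := NormalSub {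
  nsub :> grp_morph H G;
  nsub_inj : forall U : opens X, injective (nsub U);
  nsub_normal : forall (U : opens X) (g : G U) (h : H U),
    exists h' : H U, nsub U h' = (g^-1 * nsub U h * g)%g }.

Section QuotientSheaf.
Variables (X : topologicalType) (H G : grp_presheaf X) (i : normal_sub H G).

Record locsec (x : X) := LocSec {
  ldom : opens X; ldom_in : oset ldom x; lsec : G ldom }.

HB.instance Definition _ x := gen_eqMixin (locsec x).
HB.instance Definition _ x := gen_choiceMixin (locsec x).

(* a and b have germs in the same coset of H_x *)
Definition germ_eq x (a b : locsec x) : Prop :=
  exists (W : opens X) (ha : W `<=` ldom a) (hb : W `<=` ldom b) (h : H W),
    oset W x /\ pres G hb (lsec b) = (pres G ha (lsec a) * i W h)%g.

Lemma germ_eq_res x (a b : locsec x) (W : opens X) (ha : W `<=` ldom a)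
    (hb : W `<=` ldom b) :
  oset W x -> pres G hb (lsec b) = pres G ha (lsec a) -> germ_eq a b.
Proof.
by move=> Wx E; exists W, ha, hb, 1%g; rewrite pmor1 mulg1.
Qed.

Definition germ_eqb x : rel (locsec x) := fun a b => `[< germ_eq a b >].

Lemma germ_eqb_equiv x : equiv_class_of (@germ_eqb x).
Proof.
split=> [a|a b|b a c].
- by apply/asboolP/(@germ_eq_res _ _ _ _ (fun=> id) (fun=> id)) => //;
    exact: ldom_in.
- suff S (u v : locsec x) : germ_eq u v -> germ_eq v u.
    by apply/asboolP/asboolP; exact: S.
  move=> [W [ha [hb [h [Wx E]]]]]; exists W, hb, ha, h^-1%g; split=> //.
  by rewrite E pmorV mulgK.
- move=> /asboolP [W [ha [hb [h [Wx E]]]]].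
  move=> /asboolP [W' [hb' [hc [h' [Wx' E']]]]]; apply/asboolP.
  have s : oin W W' `<=` W by move=> ? [].
  have s' : oin W W' `<=` W' by move=> ? [].
  exists (oin W W'), (subset_trans s ha), (subset_trans s' hc).
  exists (pres H s h * pres H s' h')%g; split=> //.
  rewrite pmorM !pmor_res mulgA -(pres_comp ha s) -(pres_comp hc s') E' -presM.
  rewrite presM -E; congr (_ * _)%g.
  rewrite (pres_comp hb s (subset_trans s hb)).
  by rewrite (pres_comp hb' s' (subset_trans s hb)).
Qed.

Canonical germ_eqb_equiv_rel x := EquivRelPack (@germ_eqb_equiv x).

Definition qstalk x := {eq_quot @germ_eqb x}%qT.
HB.instance Definition _ x := Choice.on (qstalk x).

Definition qgerm x (a : locsec x) : qstalk x := \pi_(qstalk x)%qT a.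

Lemma qgermP x (a b : locsec x) : qgerm a = qgerm b <-> germ_eq a b.
Proof. by split=> [/eqmodP/asboolP|E] //; apply/eqmodP/asboolP. Qed.

Definition lone x := @LocSec x (ofull X) I 1%g.

Definition linv x (a : locsec x) := LocSec (ldom_in a) (lsec a)^-1%g.

Definition lmul x (a b : locsec x) :=
  @LocSec x (oin (ldom a) (ldom b)) (conj (ldom_in a) (ldom_in b))
   (pres G (@oinl _ _ _) (lsec a) * pres G (@oinr _ _ _) (lsec b))%g.

Lemma lmul_germ x (a a' b b' : locsec x) :
  germ_eq a a' -> germ_eq b b' -> germ_eq (lmul a b) (lmul a' b').
Proof.
move=> [W [ha [ha' [h [Wx E]]]]] [W' [hb [hb' [h' [Wx' E']]]]].
have s : oin W W' `<=` W by move=> ? [].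
have s' : oin W W' `<=` W' by move=> ? [].
have s1 : oin W W' `<=` ldom a by exact: (subset_trans s ha).
have s2 : oin W W' `<=` ldom a' by exact: (subset_trans s ha').
have s3 : oin W W' `<=` ldom b by exact: (subset_trans s' hb).
have s4 : oin W W' `<=` ldom b' by exact: (subset_trans s' hb').
have t1 : oin W W' `<=` ldom (lmul a b) by move=> ? ?; split; auto.
have t2 : oin W W' `<=` ldom (lmul a' b') by move=> ? ?; split; auto.
have [k Ek] := nsub_normal i (pres G s3 (lsec b)) (pres H s h).
exists (oin W W'), t1, t2, (k * pres H s' h')%g; split=> //=.
rewrite !presM (pres_comp _ _ s1) (pres_comp _ _ s2).
rewrite (pres_comp _ _ s3) (pres_comp _ _ s4).
rewrite -(pres_comp ha' s s2) -(pres_comp hb' s' s4) E E' !presM.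
rewrite (pres_comp _ _ s1) (pres_comp _ _ s3) pmorM Ek !pmor_res.
by rewrite !mulgA mulgK.
Qed.

Lemma linv_germ x (a a' : locsec x) :
  germ_eq a a' -> germ_eq (linv a) (linv a').
Proof.
move=> [W [ha [ha' [h [Wx E]]]]].
have [k Ek] := nsub_normal i (pres G ha (lsec a))^-1%g h^-1%g.
exists W, ha, ha', k; split=> //=.
by rewrite !presV E Ek pmorV invgK invgM !mulgA mulVg mul1g.
Qed.

Definition qstalk_one x : qstalk x := qgerm (lone x).
Definition qstalk_inv x (u : qstalk x) : qstalk x := qgerm (linv (repr u)).
Definition qstalk_mul x (u v : qstalk x) : qstalk x :=
  qgerm (lmul (repr u) (repr v)).

Lemma qstalk_mulE x (a b : locsec x) :
  qstalk_mul (qgerm a) (qgerm b) = qgerm (lmul a b).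
Proof. by apply/qgermP/lmul_germ; apply/qgermP; exact: reprK. Qed.

Lemma qstalk_invE x (a : locsec x) : qstalk_inv (qgerm a) = qgerm (linv a).
Proof. by apply/qgermP/linv_germ/qgermP; exact: reprK. Qed.

Lemma qgerm_repr x (u : qstalk x) : u = qgerm (repr u).
Proof. by rewrite /qgerm reprK. Qed.

Lemma qstalk_mulA x : associative (@qstalk_mul x).
Proof.
move=> u v w; rewrite (qgerm_repr u) (qgerm_repr v) (qgerm_repr w).
move: (repr u) (repr v) (repr w) => a b c; rewrite !qstalk_mulE.
have Wx := ldom_in (lmul (lmul a b) c).
apply/qgermP; set W := ldom (lmul (lmul a b) c) in Wx.
have s1 : W `<=` ldom a by move=> ? [[]].
have s2 : W `<=` ldom b by move=> ? [[]].
have s3 : W `<=` ldom c by move=> ? [[]].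
have s4 : W `<=` ldom (lmul a (lmul b c)) by move=> ? [[]] *; do 2?split.
apply: (germ_eq_res (ha := s4) (hb := fun=> id) Wx) => /=.
have s5 : W `<=` ldom (lmul a b) by move=> ? [[]] *; split.
have s6 : W `<=` ldom (lmul b c) by move=> ? [[]] *; split.
rewrite !presM !(pres_comp _ _ s5) !(pres_comp _ _ s6) !(pres_comp _ _ s1).
by rewrite !(pres_comp _ _ s2) !(pres_comp _ _ s3) mulgA.
Qed.

Lemma qstalk_mul1 x : left_id (qstalk_one x) (@qstalk_mul x).
Proof.
move=> u; rewrite (qgerm_repr u); move: (repr u) => a.
rewrite qstalk_mulE; apply/qgermP.
have s : ldom a `<=` ldom (lmul (lone x) a) by move=> y ?; split.
apply: (germ_eq_res (ha := s) (hb := fun=> id) (ldom_in a)) => /=.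
by rewrite presM !pres1 mul1g (pres_comp _ _ (fun=> id)).
Qed.

Lemma qstalk_mulV x : left_inverse (qstalk_one x) (@qstalk_inv x) (@qstalk_mul x).
Proof.
move=> u; rewrite (qgerm_repr u); move: (repr u) => a.
rewrite qstalk_invE qstalk_mulE; apply/qgermP.
have s : ldom a `<=` ldom (lmul (linv a) a) by move=> y ?; split.
have s0 : ldom a `<=` ldom (lone x) by [].
apply: (germ_eq_res (ha := s) (hb := s0) (ldom_in a)) => /=.
by rewrite presM !(pres_comp _ _ (fun=> id)) presV mulVg pres1.
Qed.

Lemma qstalk_mulr1 x : right_id (qstalk_one x) (@qstalk_mul x).
Proof.
move=> u; rewrite (qgerm_repr u); move: (repr u) => a.
rewrite qstalk_mulE; apply/qgermP.
have s : ldom a `<=` ldom (lmul a (lone x)) by move=> y ?; split.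
apply: (germ_eq_res (ha := s) (hb := fun=> id) (ldom_in a)) => /=.
by rewrite presM !pres1 mulg1 (pres_comp _ _ (fun=> id)).
Qed.

Lemma qstalk_mulrV x :
  right_inverse (qstalk_one x) (@qstalk_inv x) (@qstalk_mul x).
Proof.
move=> u; rewrite (qgerm_repr u); move: (repr u) => a.
rewrite qstalk_invE qstalk_mulE; apply/qgermP.
have s : ldom a `<=` ldom (lmul a (linv a)) by move=> y ?; split.
have s0 : ldom a `<=` ldom (lone x) by [].
apply: (germ_eq_res (ha := s) (hb := s0) (ldom_in a)) => /=.
by rewrite presM !(pres_comp _ _ (fun=> id)) presV mulgV pres1.
Qed.

HB.instance Definition _ x := isGroup.Build (qstalk x)
  (@qstalk_mulA x) (@qstalk_mul1 x) (@qstalk_mulr1 x)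
  (@qstalk_mulV x) (@qstalk_mulrV x).

Record qsec (U : opens X) := QSec {
  qfun :> forall x, oset U x -> qstalk x;
  qfun_loc : forall x, oset U x -> exists (W : opens X) (g : G W),
    oset W x /\
    forall y (hU : oset U y) (hW : oset W y), qfun hU = qgerm (LocSec hW g) }.

HB.instance Definition _ U := gen_eqMixin (qsec U).
HB.instance Definition _ U := gen_choiceMixin (qsec U).

Lemma qsec_ext U (s t : qsec U) : (forall x (hx : oset U x), s x hx = t x hx) ->
  s = t.
Proof.
case: s t => [s hs] [t ht] /= E; have {}E : s = t.
  by apply: functional_extensionality_dep => x;
     apply: functional_extensionality_dep => hx; exact: E.
by case: _ / E in ht *; congr QSec; exact: Prop_irrelevance.
Qed.

Lemma qsec_one_loc (U : opens X) x : oset U x -> exists (W : opens X) (g : G W),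
  oset W x /\ forall y (hU : oset U y) (hW : oset W y),
    (1%g : qstalk y) = qgerm (LocSec hW g).
Proof.
move=> _; exists (ofull X), 1%g; split=> // y _ hW.
by rewrite (Prop_irrelevance hW I).
Qed.

Lemma qsec_mul_loc (U : opens X) (s t : qsec U) x : oset U x ->
  exists (W : opens X) (g : G W),
  oset W x /\ forall y (hU : oset U y) (hW : oset W y),
    (s y hU * t y hU)%g = qgerm (LocSec hW g).
Proof.
move=> Ux; have [W [g [Wx Eg]]] := qfun_loc s Ux.
have [W' [g' [Wx' Eg']]] := qfun_loc t Ux.
exists (oin W W'), (pres G (@oinl _ _ _) g * pres G (@oinr _ _ _) g')%g.
split=> // y hU [hW hW']; rewrite (Eg _ _ hW) (Eg' _ _ hW').
by rewrite [LHS]qstalk_mulE.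
Qed.

Lemma qsec_inv_loc (U : opens X) (s : qsec U) x : oset U x ->
  exists (W : opens X) (g : G W),
  oset W x /\ forall y (hU : oset U y) (hW : oset W y),
    (s y hU)^-1%g = qgerm (LocSec hW g).
Proof.
move=> Ux; have [W [g [Wx Eg]]] := qfun_loc s Ux.
exists W, g^-1%g; split=> // y hU hW; rewrite (Eg _ _ hW).
by rewrite [LHS]qstalk_invE.
Qed.

Definition qsec_one U : qsec U := QSec (@qsec_one_loc U).
Definition qsec_mul U (s t : qsec U) : qsec U := QSec (qsec_mul_loc s t).
Definition qsec_inv U (s : qsec U) : qsec U := QSec (qsec_inv_loc s).

Lemma qsec_mulA U : associative (@qsec_mul U).
Proof. by move=> s t u; apply: qsec_ext => x hx /=; rewrite mulgA. Qed.
Lemma qsec_mul1 U : left_id (qsec_one U) (@qsec_mul U).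
Proof. by move=> s; apply: qsec_ext => x hx /=; rewrite mul1g. Qed.
Lemma qsec_mulr1 U : right_id (qsec_one U) (@qsec_mul U).
Proof. by move=> s; apply: qsec_ext => x hx /=; rewrite mulg1. Qed.
Lemma qsec_mulV U : left_inverse (qsec_one U) (@qsec_inv U) (@qsec_mul U).
Proof. by move=> s; apply: qsec_ext => x hx /=; rewrite mulVg. Qed.
Lemma qsec_mulrV U : right_inverse (qsec_one U) (@qsec_inv U) (@qsec_mul U).
Proof. by move=> s; apply: qsec_ext => x hx /=; rewrite mulgV. Qed.

HB.instance Definition _ U := isGroup.Build (qsec U)
  (@qsec_mulA U) (@qsec_mul1 U) (@qsec_mulr1 U) (@qsec_mulV U) (@qsec_mulrV U).

Lemma qres_loc (U V : opens X) (h : V `<=` U) (s : qsec U) x : oset V x ->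
  exists (W : opens X) (g : G W),
  oset W x /\ forall y (hV : oset V y) (hW : oset W y),
    s y (h y hV) = qgerm (LocSec hW g).
Proof.
move=> Vx; have [W [g [Wx Eg]]] := qfun_loc s (h _ Vx).
by exists W, g; split=> // y hV hW; exact: Eg.
Qed.

Definition qres (U V : opens X) (h : V `<=` U) (s : qsec U) : qsec V :=
  QSec (qres_loc h s).

Lemma qresM (U V : opens X) (h : V `<=` U) (s t : qsec U) :
  qres h (s * t)%g = (qres h s * qres h t)%g.
Proof. exact: qsec_ext. Qed.

Lemma qres_id (U : opens X) (h : U `<=` U) (s : qsec U) : qres h s = s.
Proof.
by apply: qsec_ext => x hx /=; rewrite (Prop_irrelevance (h x hx) hx).
Qed.

Lemma qres_comp (U V W : opens X) (h : V `<=` U) (k : W `<=` V) (l : W `<=` U)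
  (s : qsec U) : qres k (qres h s) = qres l s.
Proof.
by apply: qsec_ext => x hx /=; congr (qfun s); exact: Prop_irrelevance.
Qed.

Definition quot_sheaf : grp_presheaf X := GrpPresheaf qresM qres_id qres_comp.

Lemma quot_loc (U : opens X) (g : G U) x : oset U x ->
  exists (W : opens X) (g' : G W),
  oset W x /\ forall y (hU : oset U y) (hW : oset W y),
    qgerm (LocSec hU g) = qgerm (LocSec hW g').
Proof.
by move=> Ux; exists U, g; split=> // y hU hW; rewrite (Prop_irrelevance hU hW).
Qed.

Definition quot_fun (U : opens X) (g : G U) : qsec U := QSec (quot_loc g).

Lemma quot_funM (U : opens X) (g g' : G U) :
  quot_fun (g * g')%g = (quot_fun g * quot_fun g')%g.
Proof.
apply: qsec_ext => x hx; rewrite [RHS]qstalk_mulE; apply/qgermP.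
have s : U `<=` oin U U by move=> y ?; split.
apply: (@germ_eq_res x (LocSec hx (g * g')%g)
  (lmul (LocSec hx g) (LocSec hx g')) U (fun=> id) s hx).
by rewrite /= !presM !(pres_comp _ _ (fun=> id)).
Qed.

Lemma quot_fun_res (U V : opens X) (h : V `<=` U) (g : G U) :
  quot_fun (pres G h g) = qres h (quot_fun g).
Proof.
apply: qsec_ext => x hx; apply/qgermP.
apply: (germ_eq_res (a := LocSec hx (pres G h g)) (b := LocSec (h x hx) g)
  (ha := fun=> id) (hb := h) hx).
by rewrite /= pres_id.
Qed.

Definition quot_morph : grp_morph G quot_sheaf :=
  @GrpMorph _ G quot_sheaf quot_fun quot_funM quot_fun_res.
End QuotientSheaf.

(* The subpresheaf of groups defined by a predicate on sections *)
Record subgrp (X : topologicalType) (F : grp_presheaf X) := SubGrp {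
  sgmem : forall U : opens X, F U -> Prop;
  sgmem1 : forall U : opens X, sgmem (1%g : F U);
  sgmemM : forall (U : opens X) (s t : F U),
    sgmem s -> sgmem t -> sgmem (s * t)%g;
  sgmemV : forall (U : opens X) (s : F U), sgmem s -> sgmem s^-1%g;
  sgmem_res : forall (U V : opens X) (h : V `<=` U) (s : F U),
    sgmem s -> sgmem (pres F h s) }.
Arguments sgmem {X F} s U s0 : rename.

Section SubPresheaf.
Variables (X : topologicalType) (F : grp_presheaf X).

Record sgsec (P : subgrp F) (U : opens X) := SGSec {
  sgval :> F U; sgvalP : sgmem P U sgval }.

HB.instance Definition _ P U := gen_eqMixin (sgsec P U).
HB.instance Definition _ P U := gen_choiceMixin (sgsec P U).

Lemma sgval_inj P U : injective (@sgval P U).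
Proof.
by case=> [s hs] [t ht] /= E; case: _ / E in ht *; congr SGSec;
  exact: Prop_irrelevance.
Qed.

Section Ops.
Variables (P : subgrp F) (U : opens X).
Implicit Types s t : sgsec P U.

Definition sg_one : sgsec P U := SGSec (sgmem1 P U).
Definition sg_mul s t : sgsec P U := SGSec (sgmemM (sgvalP s) (sgvalP t)).
Definition sg_inv s : sgsec P U := SGSec (sgmemV (sgvalP s)).

Lemma sg_mulA : associative sg_mul.
Proof. by move=> s t u; apply: sgval_inj; rewrite /= mulgA. Qed.
Lemma sg_mul1 : left_id sg_one sg_mul.
Proof. by move=> s; apply: sgval_inj; rewrite /= mul1g. Qed.
Lemma sg_mulr1 : right_id sg_one sg_mul.
Proof. by move=> s; apply: sgval_inj; rewrite /= mulg1. Qed.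
Lemma sg_mulV : left_inverse sg_one sg_inv sg_mul.
Proof. by move=> s; apply: sgval_inj; rewrite /= mulVg. Qed.
Lemma sg_mulrV : right_inverse sg_one sg_inv sg_mul.
Proof. by move=> s; apply: sgval_inj; rewrite /= mulgV. Qed.

HB.instance Definition _ := isGroup.Build (sgsec P U)
  sg_mulA sg_mul1 sg_mulr1 sg_mulV sg_mulrV.
End Ops.

Section Presheaf.
Variable P : subgrp F.

Definition sgres (U V : opens X) (h : V `<=` U) (s : sgsec P U) : sgsec P V :=
  SGSec (sgmem_res h (sgvalP s)).

Lemma sgresM (U V : opens X) (h : V `<=` U) (s t : sgsec P U) :
  sgres h (s * t)%g = (sgres h s * sgres h t)%g.
Proof. by apply: sgval_inj; rewrite /= presM. Qed.

Lemma sgres_id (U : opens X) (h : U `<=` U) (s : sgsec P U) : sgres h s = s.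
Proof. by apply: sgval_inj; rewrite /= pres_id. Qed.

Lemma sgres_comp (U V W : opens X) (h : V `<=` U) (k : W `<=` V) (l : W `<=` U)
  (s : sgsec P U) : sgres k (sgres h s) = sgres l s.
Proof. by apply: sgval_inj; rewrite /= (pres_comp _ _ l). Qed.

Definition subpresheaf : grp_presheaf X :=
  GrpPresheaf sgresM sgres_id sgres_comp.
End Presheaf.

Section Inclusion.
Variables (P Q : subgrp F).
Hypothesis PQ : forall (U : opens X) (s : F U), sgmem P U s -> sgmem Q U s.

Definition sgincl_fun (U : opens X) (s : sgsec P U) : sgsec Q U :=
  SGSec (PQ (sgvalP s)).

Lemma sgincl_funM (U : opens X) (s t : sgsec P U) :
  sgincl_fun (s * t)%g = (sgincl_fun s * sgincl_fun t)%g.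
Proof. exact: sgval_inj. Qed.

Lemma sgincl_fun_res (U V : opens X) (h : V `<=` U) (s : sgsec P U) :
  sgincl_fun (sgres h s) = sgres h (sgincl_fun s).
Proof. exact: sgval_inj. Qed.

Definition sgincl : grp_morph (subpresheaf P) (subpresheaf Q) :=
  @GrpMorph _ (subpresheaf P) (subpresheaf Q) _ sgincl_funM sgincl_fun_res.

Lemma sgincl_inj (U : opens X) : injective (sgincl U).
Proof. by move=> s t E; apply: sgval_inj; apply: (congr1 (@sgval Q U) E). Qed.
End Inclusion.
End SubPresheaf.

Definition Cx (R : realType) : numFieldType := R[i].

(* Holomorphic means complex (Frechet) differentiable at every point.         *)
Record complex_manifold (R : realType) (n : nat) := ComplexManifold {
  mspace :> topologicalType;
  manifold_hausdorff : hausdorff_space mspace;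
  manifold_second_countable : second_countable (T := mspace);
  chart_idx : Type;
  chart_dom : chart_idx -> opens mspace;
  chart : chart_idx -> mspace -> 'rV[Cx R]_n;
  chart_inv : chart_idx -> 'rV[Cx R]_n -> mspace;
  chart_cover : open_cover chart_dom;
  chart_open : forall a, open [set chart a x | x in chart_dom a];
  chartK : forall a x, oset (chart_dom a) x -> chart_inv a (chart a x) = x;
  chart_continuous : forall a, {within chart_dom a, continuous (chart a)};
  chart_inv_continuous : forall a,
    {within [set chart a x | x in chart_dom a], continuous (chart_inv a)};
  chart_holomorphic : forall a b x,
    oset (chart_dom a) x -> oset (chart_dom b) x ->
    differentiable (chart b \o chart_inv a) (chart a x) }.

Definition holomorphic_on (R : realType) (n : nat) (M : complex_manifold R n)
    (U : set M) (f : M -> Cx R) : Prop :=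
  forall a x, U x -> oset (chart_dom a) x ->
    differentiable (f \o chart_inv a) (chart a x).

(* A holomorphic vector bundle of rank r, given by its fibres E_x and by      *)
(* local frames with holomorphic transition matrices.                         *)
Record vector_bundle (R : realType) (n : nat) (M : complex_manifold R n)
    (r : nat) := VectorBundle {
  fibre : M -> vectType (Cx R);
  frame_idx : Type;
  frame_dom : frame_idx -> opens M;
  frame : frame_idx -> forall x, r.-tuple (fibre x);
  frame_cover : open_cover frame_dom;
  frame_basis : forall a x, oset (frame_dom a) x ->
    basis_of fullv (frame a x);
  frame_holomorphic : forall a b (i j : 'I_r),
    holomorphic_on (frame_dom a `&` frame_dom b)
      (fun x => coord (frame b x) j (tnth (frame a x) i)) }.
Arguments frame_dom {R n M r} E a : rename.
Arguments frame {R n M r} E a x : rename.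

(* The C-algebra of all, not necessarily holomorphic, sections over U of a    *)
(* family of C-algebras. It is the zero ring when U is empty.                 *)
Definition fsec (K : fieldType) (X : Type) (U : set X) (F : X -> algType K) :=
  forall x, U x -> F x.

Section FibrewiseAlgebra.
Variables (K : fieldType) (X : Type) (U : set X) (F : X -> algType K).
Implicit Types s t u : fsec U F.

HB.instance Definition _ := gen_eqMixin (fsec U F).
HB.instance Definition _ := gen_choiceMixin (fsec U F).

Lemma fsec_ext s t : (forall x hx, s x hx = t x hx) -> s = t.
Proof.
by move=> E; apply: functional_extensionality_dep => x;
  apply: functional_extensionality_dep.
Qed.

Definition fsec_zero : fsec U F := fun _ _ => 0.
Definition fsec_opp s : fsec U F := fun x hx => - s x hx.
Definition fsec_add s t : fsec U F := fun x hx => s x hx + t x hx.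
Definition fsec_one : fsec U F := fun _ _ => 1.
Definition fsec_mul s t : fsec U F := fun x hx => s x hx * t x hx.
Definition fsec_scale (a : K) s : fsec U F := fun x hx => a *: s x hx.

Lemma fsec_addA : associative fsec_add.
Proof. by move=> *; apply: fsec_ext => *; apply: addrA. Qed.
Lemma fsec_addC : commutative fsec_add.
Proof. by move=> *; apply: fsec_ext => *; apply: addrC. Qed.
Lemma fsec_add0 : left_id fsec_zero fsec_add.
Proof. by move=> *; apply: fsec_ext => *; apply: add0r. Qed.
Lemma fsec_addN : left_inverse fsec_zero fsec_opp fsec_add.
Proof. by move=> *; apply: fsec_ext => *; apply: addNr. Qed.
Lemma fsec_mulA : associative fsec_mul.
Proof. by move=> *; apply: fsec_ext => *; apply: mulrA. Qed.
Lemma fsec_mul1 : left_id fsec_one fsec_mul.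
Proof. by move=> *; apply: fsec_ext => *; apply: mul1r. Qed.
Lemma fsec_mulr1 : right_id fsec_one fsec_mul.
Proof. by move=> *; apply: fsec_ext => *; apply: mulr1. Qed.
Lemma fsec_mulDl : left_distributive fsec_mul fsec_add.
Proof. by move=> *; apply: fsec_ext => *; apply: mulrDl. Qed.
Lemma fsec_mulDr : right_distributive fsec_mul fsec_add.
Proof. by move=> *; apply: fsec_ext => *; apply: mulrDr. Qed.

HB.instance Definition _ := GRing.isPzRing.Build (fsec U F)
  fsec_addA fsec_addC fsec_add0 fsec_addN
  fsec_mulA fsec_mul1 fsec_mulr1 fsec_mulDl fsec_mulDr.

Lemma fsec_scaleA a b s : fsec_scale a (fsec_scale b s) = fsec_scale (a * b) s.
Proof. by apply: fsec_ext => *; apply: scalerA. Qed.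
Lemma fsec_scale1 : left_id 1 fsec_scale.
Proof. by move=> *; apply: fsec_ext => *; apply: scale1r. Qed.
Lemma fsec_scaleDr : right_distributive fsec_scale +%R.
Proof. by move=> *; apply: fsec_ext => *; apply: scalerDr. Qed.
Lemma fsec_scaleDl s : {morph fsec_scale^~ s : a b / a + b}.
Proof. by move=> *; apply: fsec_ext => *; apply: scalerDl. Qed.

HB.instance Definition _ := GRing.Zmodule_isLmodule.Build K (fsec U F)
  fsec_scaleA fsec_scale1 fsec_scaleDr fsec_scaleDl.
End FibrewiseAlgebra.

Section HolomorphicSections.
Variables (R : realType) (n : nat) (M : complex_manifold R n) (r : nat).
Variable E : vector_bundle M r.

Definition extfibre (x : M) : algType (Cx R) := extalg (fibre E x).

(* v restricts to a section of the sheaf of holomorphic sections of E over U  *)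
Definition holomorphic_sec (U : set M) (v : forall x, fibre E x) : Prop :=
  forall a (j : 'I_r), holomorphic_on (U `&` frame_dom E a)
    (fun x => coord (frame E a x) j (v x)).

(* \wedge E is the sheaf of algebras generated by the holomorphic functions   *)
(* and the holomorphic sections of E: a section is locally a finite sum of    *)
(* products f . v_1 /\ ... /\ v_m. The sum is indexed by a list of pairs      *)
(* (f, [:: v_1; ...; v_m]).                                                   *)
Definition ext_holomorphic (U : opens M) (s : fsec U extfibre) : Prop :=
  forall x, oset U x ->
  exists (W : opens M) (L : seq ((M -> Cx R) * seq (forall y, fibre E y))),
  [/\ oset W x,
      forall p, p \in L -> holomorphic_on W p.1 /\
        forall v, v \in p.2 -> holomorphic_sec W v &
      forall y (hU : oset U y), oset W y -> s y hU =
        \sum_(p <- L) p.1 y *: \prod_(v <- p.2) (ext_vec (v y) : extfibre y)].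

Definition ext_holomorphicb (U : opens M) : pred (fsec U extfibre) :=
  fun s => `[< ext_holomorphic s >].
Arguments ext_holomorphicb U : clear implicits.

Lemma holomorphic_onS (U V : set M) f :
  V `<=` U -> holomorphic_on U f -> holomorphic_on V f.
Proof. by move=> VU hf a x Vx; apply: hf; exact: VU. Qed.

Lemma holomorphic_secS (U V : set M) v :
  V `<=` U -> holomorphic_sec U v -> holomorphic_sec V v.
Proof.
by move=> VU hv a j; apply: holomorphic_onS (hv a j); exact: setSI.
Qed.

Lemma holomorphic_on_cst (U : set M) (c : Cx R) : holomorphic_on U (fun=> c).
Proof. by move=> a x _ _; exact: differentiable_cst. Qed.

Lemma holomorphic_onM (U : set M) f g :
  holomorphic_on U f -> holomorphic_on U g ->
  holomorphic_on U (fun x => f x * g x).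
Proof. by move=> hf hg a x Ux ax; exact: differentiableM (hf _ _ Ux ax) (hg _ _ Ux ax). Qed.

Lemma ext_holomorphic_ring (U : opens M) :
  subring_closed (ext_holomorphicb U).
Proof.
split=> [|s t|s t].
- apply/asboolP => x Ux; exists U, [:: (fun=> 1, [::])]; split=> //.
    move=> p; rewrite mem_seq1 => /eqP ->; split=> //.
    exact: holomorphic_on_cst.
  by move=> y hU _; rewrite big_seq1 /= big_nil scale1r.
- move=> /asboolP hs /asboolP ht; apply/asboolP => x Ux.
  have [W [L [Wx HL EL]]] := hs x Ux; have [W' [L' [Wx' HL' EL']]] := ht x Ux.
  exists (oin W W'), (L ++ [seq (fun y => - 1 * p.1 y, p.2) | p <- L']).
  split=> [//|p|y hU [Wy Wy']].
    rewrite mem_cat => /orP[/HL[h1 h2]|/mapP[q /HL'[h1 h2] ->]] /=.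
      split; first exact: holomorphic_onS (@oinl _ _ _) h1.
      by move=> v /h2; exact: holomorphic_secS (@oinl _ _ _).
    split.
      apply: holomorphic_onM; first exact: holomorphic_on_cst.
      exact: holomorphic_onS (@oinr _ _ _) h1.
    by move=> v /h2; exact: holomorphic_secS (@oinr _ _ _).
  rewrite big_cat big_map /= [LHS]/(s y hU - t y hU) (EL _ _ Wy) (EL' _ _ Wy').
  congr (_ + _); rewrite -sumrN; apply: eq_bigr => p _.
  by rewrite mulN1r scaleNr.
- move=> /asboolP hs /asboolP ht; apply/asboolP => x Ux.
  have [W [L [Wx HL EL]]] := hs x Ux; have [W' [L' [Wx' HL' EL']]] := ht x Ux.
  exists (oin W W'),
    [seq (fun y => p.1 y * q.1 y, p.2 ++ q.2) | p <- L, q <- L'].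
  split=> [//|p|y hU [Wy Wy']].
    move=> /allpairsP[[p1 p2] [/HL[h1 h2] /HL'[h3 h4] ->]] /=; split.
      apply: holomorphic_onM; first exact: holomorphic_onS (@oinl _ _ _) h1.
      exact: holomorphic_onS (@oinr _ _ _) h3.
    move=> v; rewrite mem_cat => /orP[/h2|/h4].
      exact: holomorphic_secS (@oinl _ _ _).
    exact: holomorphic_secS (@oinr _ _ _).
  transitivity (s y hU * t y hU) => //; rewrite (EL _ _ Wy) (EL' _ _ Wy').
  rewrite big_flatten big_map mulr_suml; apply: eq_bigr => p _.
  rewrite big_map mulr_sumr; apply: eq_bigr => q _.
  by rewrite big_cat /= -scalerAl -scalerAr scalerA.
Qed.

Lemma ext_holomorphic_scale (U : opens M) :
  subsemimod_closed (ext_holomorphicb U).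
Proof.
case: (ext_holomorphic_ring U) => h1 hB hM.
have h0 : 0 \in ext_holomorphicb U by rewrite -(subrr 1); exact: (hB).
split; first split=> // s t hs ht.
  by rewrite -[t]opprK -[- t]add0r; apply: (hB) => //; exact: (hB).
move=> a s hs; have -> : a *: s = (a *: (1 : fsec U extfibre)) * (s : fsec U extfibre).
  by apply: fsec_ext => x hx; rewrite -[LHS]/(a *: s x hx)
    -[RHS]/((a *: 1) * s x hx) -scalerAl mul1r.
apply: hM => //; apply/asboolP => x Ux; exists U, [:: (fun=> a, [::])].
split=> //.
  move=> p; rewrite mem_seq1 => /eqP ->; split=> //.
  exact: holomorphic_on_cst.
by move=> y hU _; rewrite big_seq1 /= big_nil.
Qed.

(* Sections over U of the sheaf \wedge E *)
Record extsec (U : opens M) := ExtSec {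
  esec :> fsec U extfibre; esecP : esec \in ext_holomorphicb U }.

HB.instance Definition _ U := [isSub for @esec U].
HB.instance Definition _ U := [Choice of extsec U by <:].
HB.instance Definition _ U := GRing.SubChoice_isSubPzRing.Build _ _ (extsec U)
  (ext_holomorphic_ring U).
HB.instance Definition _ U := GRing.SubZmodule_isSubLmodule.Build _ _ _
  (extsec U) (ext_holomorphic_scale U).

Lemma extres_hol (U V : opens M) (h : V `<=` U) (s : extsec U) :
  ((fun x hx => esec s (h x hx)) : fsec V extfibre) \in ext_holomorphicb V.
Proof.
apply/asboolP => x Vx; have /asboolP hs := esecP s.
have [W [L [Wx HL EL]]] := hs x (h x Vx).
by exists W, L; split=> // y hV Wy; exact: EL.
Qed.

Definition extres (U V : opens M) (h : V `<=` U) (s : extsec U) : extsec V :=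
  ExtSec (extres_hol h s).
End HolomorphicSections.

Section AutSheaf.
Variables (R : realType) (n : nat) (M : complex_manifold R n) (r : nat).
Variable E : vector_bundle M r.
Local Notation A := (extsec E).
Implicit Types U V W : opens M.

Lemma extsec_ext U (s t : A U) :
  (forall x (hx : oset U x), esec s hx = esec t hx) -> s = t.
Proof. by move=> st; apply: val_inj; exact: fsec_ext. Qed.

Lemma extresD U V (h : V `<=` U) (s t : A U) :
  extres h (s + t) = extres h s + extres h t.
Proof. exact: extsec_ext. Qed.

Lemma extresN U V (h : V `<=` U) (s : A U) : extres h (- s) = - extres h s.
Proof. exact: extsec_ext. Qed.

Lemma extresM U V (h : V `<=` U) (s t : A U) :
  extres h (s * t) = extres h s * extres h t.
Proof. exact: extsec_ext. Qed.

Lemma extres_comp U V W (h : V `<=` U) (k : W `<=` V) (l : W `<=` U) (s : A U) :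
  extres k (extres h s) = extres l s.
Proof.
by apply: extsec_ext => x hx /=; congr (esec s); exact: Prop_irrelevance.
Qed.

(* sections of the direct sum of the \wedge^j E, j \in P *)
Definition graded_in (P : pred nat) U (s : A U) : Prop :=
  forall x (hx : oset U x), ext_in P (esec s hx).

Definition even_sec U (s : A U) := graded_in (fun j => ~~ odd j) s.
Definition odd_sec U (s : A U) := graded_in odd s.

(* the ideal J = \bigoplus_(j > 0) \wedge^j E *)
Definition idealJ U (s : A U) := graded_in (leq 1) s.

(* the powers of the sheaf of ideals J: J^(k+1) = J^k J is the sheaf of the   *)
(* sections that are locally finite sums of products a b, a in J^k, b in J    *)
Fixpoint powJ (k : nat) U (s : A U) {struct k} : Prop :=
  if k is k'.+1 then
    forall x, oset U x -> exists W (h : W `<=` U) (L : seq (A W * A W)),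
    [/\ oset W x,
        forall p, p \in L -> powJ k' p.1 /\ idealJ p.2 &
        extres h s = \sum_(p <- L) p.1 * p.2]
  else True.

(* A Z_2-grading preserving endomorphism of the restriction to U of the sheaf *)
(* of C-algebras \wedge E; it need not be linear over holomorphic functions.  *)
Record extend U := ExtEnd {
  efun : forall V, V `<=` U -> A V -> A V;
  efun_linear : forall V (h : V `<=` U), linear (efun h);
  efun_monoid : forall V (h : V `<=` U), GRing.monoid_morphism (efun h);
  efun_even : forall V (h : V `<=` U) (s : A V),
    even_sec s -> even_sec (efun h s);
  efun_odd : forall V (h : V `<=` U) (s : A V), odd_sec s -> odd_sec (efun h s);
  efun_res : forall V W (h : V `<=` U) (k : W `<=` V) (l : W `<=` U) (s : A V),
    extres k (efun h s) = efun l (extres k s) }.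
Arguments efun {U} e V h s : rename.

Lemma extend_ext U (f g : extend U) :
  (forall V (h : V `<=` U) s, efun f V h s = efun g V h s) -> f = g.
Proof.
case: f g => [f f1 f2 f3 f4 f5] [g g1 g2 g3 g4 g5] /= fg.
have {}fg : f = g.
  apply: functional_extensionality_dep => V.
  apply: functional_extensionality_dep => h; exact/funext/fg.
case: _ / fg in g1 g2 g3 g4 g5 *.
by congr ExtEnd; exact: Prop_irrelevance.
Qed.

Lemma eid_linear U V (h : V `<=` U) : linear (@id (A V)).
Proof. by []. Qed.
Lemma eid_monoid U V (h : V `<=` U) : GRing.monoid_morphism (@id (A V)).
Proof. by []. Qed.

Definition extend_id U : extend U :=
  @ExtEnd U (fun V _ s => s) (@eid_linear U) (@eid_monoid U)
    (fun _ _ _ => id) (fun _ _ _ => id) (fun _ _ _ _ _ _ => erefl).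

Section Comp.
Variables (U : opens M) (f g : extend U).

Lemma ecomp_linear V (h : V `<=` U) : linear (fun s => efun f V h (efun g V h s)).
Proof. by move=> a s t; rewrite !efun_linear. Qed.
Lemma ecomp_monoid V (h : V `<=` U) :
  GRing.monoid_morphism (fun s => efun f V h (efun g V h s)).
Proof.
have [f1 fM] := efun_monoid f h; have [g1 gM] := efun_monoid g h.
by split=> [|s t]; rewrite ?g1 ?gM.
Qed.
Lemma ecomp_even V (h : V `<=` U) (s : A V) :
  even_sec s -> even_sec (efun f V h (efun g V h s)).
Proof. by move=> hs; do 2 apply: efun_even. Qed.
Lemma ecomp_odd V (h : V `<=` U) (s : A V) :
  odd_sec s -> odd_sec (efun f V h (efun g V h s)).
Proof. by move=> hs; do 2 apply: efun_odd. Qed.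
Lemma ecomp_res V W (h : V `<=` U) (k : W `<=` V) (l : W `<=` U) (s : A V) :
  extres k (efun f V h (efun g V h s)) = efun f W l (efun g W l (extres k s)).
Proof. by rewrite !(efun_res _ _ _ l). Qed.

Definition extend_comp : extend U :=
  ExtEnd ecomp_linear ecomp_monoid ecomp_even ecomp_odd ecomp_res.
End Comp.

Definition extend_res U U' (k : U' `<=` U) (f : extend U) : extend U' :=
  @ExtEnd U' (fun V h => efun f V (subset_trans h k))
    (fun V h => efun_linear f _) (fun V h => efun_monoid f _)
    (fun V h => @efun_even U f V (subset_trans h k))
    (fun V h => @efun_odd U f V (subset_trans h k))
    (fun V W h j l => efun_res f _ j _).

(* Sections over U of the sheaf of automorphisms of \wedge E *)
Record extaut U := ExtAut {
  afun :> extend U;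
  ainv : extend U;
  afunK : extend_comp ainv afun = extend_id U;
  ainvK : extend_comp afun ainv = extend_id U }.

HB.instance Definition _ U := gen_eqMixin (extaut U).
HB.instance Definition _ U := gen_choiceMixin (extaut U).

Lemma extaut_invK U (f : extaut U) V (h : V `<=` U) (s : A V) :
  efun (ainv f) V h (efun f V h s) = s.
Proof. by have := congr1 (fun g => efun g V h s) (afunK f). Qed.

Lemma extaut_funK U (f : extaut U) V (h : V `<=` U) (s : A V) :
  efun f V h (efun (ainv f) V h s) = s.
Proof. by have := congr1 (fun g => efun g V h s) (ainvK f). Qed.

Lemma extaut_ext U (f g : extaut U) :
  (forall V (h : V `<=` U) s, efun f V h s = efun g V h s) -> f = g.
Proof.
move=> fg; have fgE : afun f = afun g by exact: extend_ext.
have fgI : ainv f = ainv g.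
  apply: extend_ext => V h s.
  by rewrite -[in RHS](extaut_funK f h s) fgE extaut_invK.
case: f g fgE fgI {fg} => [f f' f1 f2] [g g' g1 g2] /= E1 E2.
case: _ / E1 in g1 g2 *; case: _ / E2 in g1 g2 *.
by congr ExtAut; exact: Prop_irrelevance.
Qed.

Lemma aone_subproof U : extend_comp (extend_id U) (extend_id U) = extend_id U.
Proof. exact: extend_ext. Qed.
Definition aone U := ExtAut (aone_subproof U) (aone_subproof U).

Lemma amul_subproof1 U (f g : extaut U) :
  extend_comp (extend_comp (ainv g) (ainv f)) (extend_comp f g) = extend_id U.
Proof. by apply: extend_ext => V h s /=; rewrite !extaut_invK. Qed.
Lemma amul_subproof2 U (f g : extaut U) :
  extend_comp (extend_comp f g) (extend_comp (ainv g) (ainv f)) = extend_id U.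
Proof. by apply: extend_ext => V h s /=; rewrite !extaut_funK. Qed.
Definition amul U (f g : extaut U) : extaut U :=
  ExtAut (amul_subproof1 f g) (amul_subproof2 f g).

Definition ainvaut U (f : extaut U) : extaut U := ExtAut (ainvK f) (afunK f).

Lemma amulA U : associative (@amul U).
Proof. by move=> f g h; exact: extaut_ext. Qed.
Lemma amul1 U : left_id (aone U) (@amul U).
Proof. by move=> f; exact: extaut_ext. Qed.
Lemma amulr1 U : right_id (aone U) (@amul U).
Proof. by move=> f; exact: extaut_ext. Qed.
Lemma amulV U : left_inverse (aone U) (@ainvaut U) (@amul U).
Proof. by move=> f; apply: extaut_ext => V h s; exact: extaut_invK. Qed.
Lemma amulrV U : right_inverse (aone U) (@ainvaut U) (@amul U).
Proof. by move=> f; apply: extaut_ext => V h s; exact: extaut_funK. Qed.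

HB.instance Definition _ U := isGroup.Build (extaut U)
  (@amulA U) (@amul1 U) (@amulr1 U) (@amulV U) (@amulrV U).

Lemma extaut_res_subproof1 U U' (k : U' `<=` U) (f : extaut U) :
  extend_comp (extend_res k (ainv f)) (extend_res k f) = extend_id U'.
Proof. by apply: extend_ext => V h s; exact: extaut_invK. Qed.
Lemma extaut_res_subproof2 U U' (k : U' `<=` U) (f : extaut U) :
  extend_comp (extend_res k f) (extend_res k (ainv f)) = extend_id U'.
Proof. by apply: extend_ext => V h s; exact: extaut_funK. Qed.
Definition extaut_res U U' (k : U' `<=` U) (f : extaut U) : extaut U' :=
  ExtAut (extaut_res_subproof1 k f) (extaut_res_subproof2 k f).

Lemma extaut_resM U U' (k : U' `<=` U) (f g : extaut U) :
  extaut_res k (f * g)%g = (extaut_res k f * extaut_res k g)%g.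
Proof. exact: extaut_ext. Qed.
Lemma extaut_res_id U (k : U `<=` U) (f : extaut U) : extaut_res k f = f.
Proof.
by apply: extaut_ext => V h s /=; congr (efun f _ _ s); exact: Prop_irrelevance.
Qed.
Lemma extaut_res_comp U V W (h : V `<=` U) (k : W `<=` V) (l : W `<=` U)
  (f : extaut U) : extaut_res k (extaut_res h f) = extaut_res l f.
Proof.
by apply: extaut_ext => V' h' s /=; congr (efun f _ _ s); exact: Prop_irrelevance.
Qed.

Definition Aut_sheaf : grp_presheaf M :=
  GrpPresheaf extaut_resM extaut_res_id extaut_res_comp.

Lemma efun0 U (f : extend U) V (h : V `<=` U) : efun f V h 0 = 0.
Proof.
have := efun_linear f h (-1) 0 0.
by rewrite scaler0 addr0 scaleN1r addNr.
Qed.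
Lemma efunD U (f : extend U) V (h : V `<=` U) s t :
  efun f V h (s + t) = efun f V h s + efun f V h t.
Proof. by have := efun_linear f h 1 s t; rewrite !scale1r. Qed.
Lemma efunN U (f : extend U) V (h : V `<=` U) s :
  efun f V h (- s) = - efun f V h s.
Proof.
by have := efun_linear f h (-1) s 0; rewrite efun0 !addr0 !scaleN1r.
Qed.
Lemma efunB U (f : extend U) V (h : V `<=` U) s t :
  efun f V h (s - t) = efun f V h s - efun f V h t.
Proof. by rewrite efunD efunN. Qed.
Lemma efunM U (f : extend U) V (h : V `<=` U) s t :
  efun f V h (s * t) = efun f V h s * efun f V h t.
Proof. by have [_] := efun_monoid f h; apply. Qed.
Lemma efun1 U (f : extend U) V (h : V `<=` U) : efun f V h 1 = 1.
Proof. by have [] := efun_monoid f h. Qed.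

Lemma esecX U (s : A U) k x (hx : oset U x) :
  esec (s ^+ k) hx = (esec s hx : extfibre E x) ^+ k.
Proof. by elim: k => // k IH; rewrite !exprS -IH. Qed.

Lemma idealJ_nilp U (s : A U) : idealJ s -> s ^+ r.+1 = 0.
Proof.
move=> hs; apply: extsec_ext => x hx; rewrite esecX.
have [a ax] := frame_cover E x.
have := ext_in_nilp (hs x hx); rewrite [X in _ ^+ X.+1](size_basis (frame_basis ax)).
exact: id.
Qed.

(* f(J) \subset J because J consists of the nilpotent sections *)
Lemma idealJ_endo U (f : extend U) V (h : V `<=` U) (s : A V) :
  idealJ s -> idealJ (efun f V h s).
Proof.
move=> /idealJ_nilp s0 x hx; apply/ext_in1P; apply/eqP.
have F k (u : extfibre E x) : (u ^+ k) finset.set0 = (u finset.set0) ^+ k.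
  elim: k => [|k IH]; first by rewrite !expr0 [LHS]ffunE eqxx.
  by rewrite !exprS -IH; exact: ext_mul0.
have : (esec (efun f V h s ^+ r.+1) hx : extfibre E x) finset.set0 = 0.
  have -> : efun f V h s ^+ r.+1 = efun f V h (s ^+ r.+1).
    by elim: {s0} r.+1 => [|k IH]; rewrite ?efun1 // !exprS efunM IH.
  by rewrite s0 efun0 [LHS]ffunE.
by rewrite esecX F => /eqP; rewrite expf_eq0 => /andP[].
Qed.

Lemma idealJ_res U V (h : V `<=` U) (s : A U) : idealJ s -> idealJ (extres h s).
Proof. by move=> hs x hx; exact: hs. Qed.

Lemma powJ_res k U V (h : V `<=` U) (s : A U) : powJ k s -> powJ k (extres h s).
Proof.
elim: k U V h s => [//|k IH] U V h s hs x Vx.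
have [W [hW [L [Wx HL EL]]]] := hs x (h x Vx).
pose j := @oinl _ W V : oin W V `<=` W.
exists (oin W V), (@oinr _ W V), [seq (extres j p.1, extres j p.2) | p <- L].
split=> //.
  by move=> _ /mapP[q /HL[h1 h2] ->]; split; [exact: IH|exact: idealJ_res].
rewrite (extres_comp _ _ (subset_trans j hW)) -(extres_comp hW j) EL big_map.
elim: L {HL EL} => [|p L IHL]; first by rewrite !big_nil; exact: extsec_ext.
by rewrite !big_cons extresD IHL extresM.
Qed.

Lemma powJD k U (s t : A U) : powJ k s -> powJ k t -> powJ k (s + t).
Proof.
case: k => [//|k] hs ht x Ux.
have [W [hW [L [Wx HL EL]]]] := hs x Ux.
have [W' [hW' [L' [Wx' HL' EL']]]] := ht x Ux.
pose j := @oinl _ W W' : oin W W' `<=` W.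
pose j' := @oinr _ W W' : oin W W' `<=` W'.
exists (oin W W'), (subset_trans j hW),
  ([seq (extres j p.1, extres j p.2) | p <- L] ++
   [seq (extres j' p.1, extres j' p.2) | p <- L']).
split=> //.
  move=> q; rewrite mem_cat => /orP[/mapP[p /HL[h1 h2] ->]|/mapP[p /HL'[h1 h2] ->]].
    by split; [exact: powJ_res|exact: idealJ_res].
  by split; [exact: powJ_res|exact: idealJ_res].
have S V (i : oin W W' `<=` V) (K : seq (A V * A V)) :
  extres i (\sum_(p <- K) p.1 * p.2) =
  \sum_(p <- K) extres i p.1 * extres i p.2.
  elim: K => [|p K IHK]; first by rewrite !big_nil; exact: extsec_ext.
  by rewrite !big_cons extresD IHK extresM.
rewrite extresD -{1}(extres_comp hW j) EL S.
by rewrite -(extres_comp hW' j') EL' S big_cat !big_map.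
Qed.

Lemma powJN k U (s : A U) : powJ k s -> powJ k (- s).
Proof.
elim: k U s => [//|k IH] U s hs x Ux.
have [W [hW [L [Wx HL EL]]]] := hs x Ux.
exists W, hW, [seq (- p.1, p.2) | p <- L]; split=> //.
  by move=> _ /mapP[q /HL[h1 h2] ->]; split=> //; exact: IH.
by rewrite extresN EL big_map -sumrN; apply: eq_bigr => p _; rewrite mulNr.
Qed.

Lemma powJ_endo k U (f : extend U) V (h : V `<=` U) (s : A V) :
  powJ k s -> powJ k (efun f V h s).
Proof.
elim: k V h s => [//|k IH] V h s hs x Vx.
have [W [hW [L [Wx HL EL]]]] := hs x Vx.
have hWU : W `<=` U by exact: subset_trans h.
exists W, hW, [seq (efun f W hWU p.1, efun f W hWU p.2) | p <- L]; split=> //.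
  by move=> _ /mapP[q /HL[h1 h2] ->]; split; [exact: IH|exact: idealJ_endo].
rewrite (efun_res _ _ _ hWU) EL big_map.
elim: L {HL EL} => [|p L IHL]; first by rewrite !big_nil efun0.
by rewrite !big_cons efunD IHL efunM.
Qed.

Lemma powJS k U (s : A U) : powJ k.+1 s -> powJ k s.
Proof.
elim: k U s => [//|k IH] U s hs x Ux.
have [W [hW [L [Wx HL EL]]]] := hs x Ux.
by exists W, hW, L; split=> // p /HL[h1 h2]; split=> //; exact: IH.
Qed.

(* The sheaves G^(k) *)
Definition in_G k U (f : extaut U) : Prop :=
  forall V (h : V `<=` U) (s : A V), powJ k (efun f V h s - s).

Lemma in_G1 k U : in_G k (1%g : extaut U).
Proof.
move=> V h s; rewrite subrr.
case: k => [//|k] x Vx; exists V, (fun=> id), [::]; split=> //.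
by rewrite big_nil; exact: extsec_ext.
Qed.

Lemma in_GM k U (f g : extaut U) : in_G k f -> in_G k g -> in_G k (f * g)%g.
Proof.
move=> hf hg V h s.
have -> : efun (f * g)%g V h s - s = (efun f V h (efun g V h s) - efun g V h s)
  + (efun g V h s - s) by rewrite addrA subrK.
by apply: powJD; [exact: hf|exact: hg].
Qed.

Lemma in_GV k U (f : extaut U) : in_G k f -> in_G k f^-1%g.
Proof.
move=> hf V h s; rewrite -opprB; apply: powJN.
by rewrite -{1}(extaut_funK f h s); exact: hf.
Qed.

Lemma in_G_res k U V (h : V `<=` U) (f : extaut U) :
  in_G k f -> in_G k (extaut_res h f).
Proof. by move=> hf W l s; exact: hf. Qed.

Definition Gsub k : subgrp Aut_sheaf :=
  @SubGrp _ Aut_sheaf (@in_G k) (@in_G1 k) (@in_GM k) (@in_GV k) (@in_G_res k).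

Definition Gsheaf k : grp_presheaf M := subpresheaf (Gsub k).

Lemma in_GS k U (f : extaut U) : in_G k.+1 f -> in_G k f.
Proof. by move=> hf V h s; exact/powJS/hf. Qed.

Lemma in_G_le k l U (f : extaut U) : (k <= l)%N -> in_G l f -> in_G k f.
Proof.
by move=> /subnK <-; elim: (l - k)%N => //= d IH; rewrite addSn => /in_GS/IH.
Qed.

Definition Gincl k l (kl : (k <= l)%N) : grp_morph (Gsheaf l) (Gsheaf k) :=
  @sgincl _ _ (Gsub l) (Gsub k) (fun U f => in_G_le kl).

Lemma Gincl_normal k U (g : Gsheaf k U) (h : Gsheaf k.+1 U) :
  exists h' : Gsheaf k.+1 U,
    Gincl (leqnSn k) U h' = (g^-1 * Gincl (leqnSn k) U h * g)%g.
Proof.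
have hh : in_G k.+1 ((sgval g)^-1 * sgval h * sgval g)%g.
  move=> V l s.
  have -> : efun ((sgval g)^-1 * sgval h * sgval g)%g V l s - s =
    efun (ainv (sgval g)) V l (efun (sgval h) V l (efun (sgval g) V l s)
      - efun (sgval g) V l s) by rewrite efunB extaut_invK.
  by apply: powJ_endo; exact: (sgvalP h).
by exists (SGSec (P := Gsub k.+1) hh); exact: sgval_inj.
Qed.

Definition Gnormal k : normal_sub (Gsheaf k.+1) (Gsheaf k) :=
  @NormalSub _ _ _ (Gincl (leqnSn k)) (@sgincl_inj _ _ _ _ _) (@Gincl_normal k).

(* The k-th obstruction sheaf Q^(k) = G^(k) / G^(k+1) *)
Definition Qsheaf k : grp_presheaf M := quot_sheaf (Gnormal k).

Definition Gquot k : grp_morph (Gsheaf k) (Qsheaf k) := quot_morph (Gnormal k).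

Definition supermanifold := H1 (Gsheaf 2).

(* (k-1)-split atlases *)
Definition split_atlas k := H1 (Gsheaf k).

Definition associated_supermanifold k (k2 : (2 <= k)%N) (a : split_atlas k) :
  supermanifold := H1map (Gincl k2) a.

Definition primary_obstruction k (a : split_atlas k) : H1 (Qsheaf k) :=
  H1map (Gquot k) a.

Definition obstructed k (a : split_atlas k) : Prop :=
  primary_obstruction a <> H1pt (Qsheaf k).

Definition strongly_split k (k2 : (2 < k)%N) (a : split_atlas k) : Prop :=
  associated_supermanifold (ltnW k2) a = H1pt (Gsheaf 2).

Definition exotic k (k2 : (2 < k)%N) (a : split_atlas k) : Prop :=
  obstructed a /\ strongly_split k2 a.

Definition good_model : Prop :=
  forall (S : supermanifold) (k : nat) (k2 : (2 < k)%N),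
    ~ exists a : split_atlas k,
        associated_supermanifold (ltnW k2) a = S /\ exotic k2 a.
End AutSheaf.

(* global sections *)
Definition H0 (X : topologicalType) (F : grp_presheaf X) : groupType :=
  F (ofull X).

Definition H0map (X : topologicalType) (F G : grp_presheaf X)
  (f : grp_morph F G) : H0 F -> H0 G := f (ofull X).

(* exactness of {e} -> A -> B -> C -> {e} *)
Definition short_exact (A B C : groupType) (f : A -> B) (g : B -> C) : Prop :=
  [/\ forall a, f a = 1%g <-> a = 1%g,
      forall b, g b = 1%g <-> exists a, f a = b &
      forall c, exists b, g b = c].

(* Main.v *)
Require Import Defs.
From mathcomp Require Import all_boot all_order all_algebra.
From mathcomp Require Import reals.
From mathcomp Require Import boolp classical_sets topology.

Set Implicit Arguments.
Unset Strict Implicit.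
Unset Printing Implicit Defensive.

Import GRing.Theory.
Local Open Scope classical_set_scope.
Local Open Scope ring_scope.

(** Let H be a normal subsheaf of G with quotient Q.  The quotient sequence
    continues to an exact sequence of pointed sets
      H^0(G) -> H^0(Q) -> H^1(H) -> H^1(G) -> H^1(Q),
    and exactness at H^0(Q) and H^1(H) says that H^0(G) -> H^0(Q) is onto
    exactly when H^1(H) -> H^1(G) has trivial kernel.  In one direction the
    local lifts of a global section of Q differ by a cocycle of H, which is
    trivial in G; trivialising it in H makes the lifts glue
    (H0_surj_of_H1_kernel).  In the other, a trivialisation in G of a cocycle
    of H defines a global section of Q, and a global lift of that section
    translates the trivialisation into H (H1_kernel_of_H0_surj).

    Take H = G^(k+1) and G = G^(k).  If all the maps on global sections are
    onto, then composing the kernels shows that H^1(G^(k)) -> H^1(G^(2)) has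
    trivial kernel for all k >= 2; a strongly split atlas is then the
    basepoint, hence unobstructed, and the model is good (good_of_H0_surj).

    Conversely, call the elements of H^1(G^(k)) atlases of level k.  A strongly
    split atlas of level k in a good model is unobstructed, so exactness at H^1(G) lifts it to an atlas of level k + 1
    (H1_lift), which is strongly split again.  The process ends, because
    J^(r+1) = 0 for a bundle of rank r makes G^(k) the trivial sheaf as soon as
    k > r (Gsheaf_trivial): every strongly split atlas is the image of the
    basepoint (good_kernel_trivial).  So H^1(G^(k+1)) -> H^1(G^(k)) has trivial
    kernel, and H^0(G^(k)) -> H^0(Q^(k)) is onto.

    The connecting arguments glue local sections, so the G^(k) have to be
    sheaves: automorphisms of the exterior algebra glue because they act on
    sections locally (Aut_sheaf_gluing), and membership in G^(k) is a local
    condition because the powers of J are (in_G_local). *)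

(** * Cech cohomology of presheaves of groups *)

Section Cech.
Variable X : topologicalType.
Implicit Types (F G H : grp_presheaf X).

Definition sheaf_locality F := forall (U : opens X) (s t : F U),
  (forall x, oset U x -> exists (W : opens X) (h : W `<=` U),
     oset W x /\ pres F h s = pres F h t) -> s = t.

Definition sheaf_gluing F := forall (U : opens X) (I : Type) (W : I -> opens X)
    (WU : forall i, W i `<=` U) (s : forall i, F (W i)),
  (forall x, oset U x -> exists i, oset (W i) x) ->
  (forall i j (V : opens X) (hi : V `<=` W i) (hj : V `<=` W j),
     pres F hi (s i) = pres F hj (s j)) ->
  exists t : F U, forall i, pres F (WU i) t = s i.

(** The cocycles cohomologous to the trivial one: the trivial cocycle has a
    single patch, so a refinement carries no data on its side. *)
Definition coboundary F (c : cocycle F) := exists (K : Type)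
    (W : K -> opens X) (a : K -> cidx c) (t : forall k, F (W k)),
  [/\ open_cover W, forall k, W k `<=` ccov (a k) &
      forall k l (V : opens X) (hk : V `<=` W k) (hl : V `<=` W l)
        (ha : V `<=` oin (ccov (a k)) (ccov (a l))),
      (pres F hk (t k) * pres F ha (csec (a k) (a l)) = pres F hl (t l))%g].

Lemma H1_eqP F (c d : cocycle F) :
  \pi_(H1 F)%qT c = \pi_(H1 F)%qT d <-> cohomologous c d.
Proof. by split=> [/eqmodP/asboolP|cd] //; apply/eqmodP/asboolP. Qed.

Definition triv_idx F : cidx (triv_cocycle F) :=
  exist (fun U => U = ofull X) (ofull X) erefl.

Lemma H1_ptP F (c : cocycle F) : \pi_(H1 F)%qT c = H1pt F <-> coboundary c.
Proof.
rewrite /H1pt H1_eqP; split.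
  move=> [K [W [a [b [t [cW ha hb ht]]]]]]; exists K, W, a, t; split=> //.
  move=> k l V hk hl h.
  have hbb : V `<=` oin (ccov (b k)) (ccov (b l)).
    by move=> x Vx; split; [exact/hb/hk|exact/hb/hl].
  by rewrite (ht _ _ _ hk hl h hbb) /= pres1 mul1g.
move=> [K [W [a [t [cW ha ht]]]]].
exists K, W, a, (fun=> triv_idx F), t; split=> //.
by move=> k l V hk hl h h'; rewrite (ht _ _ _ hk hl h) /= pres1 mul1g.
Qed.

Lemma H1_ind F (P : H1 F -> Prop) : (forall c, P (\pi_(H1 F)%qT c)) -> forall a, P a.
Proof. by move=> Pc a; rewrite -[a]reprK. Qed.

Lemma H1map_id F (f : grp_morph F F) :
  (forall (U : opens X) (s : F U), f U s = s) -> forall a, H1map f a = a.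
Proof.
move=> fE; apply: H1_ind => c; rewrite H1map_pi H1_eqP.
exists (cidx c), (@ccov _ _ c), id, id, (fun=> 1%g).
split=> [|k x|k x|k l V hk hl h1 h2] //; first exact: ccov_cover.
by rewrite !pres1 mul1g mulg1 /= fE (Prop_irrelevance h1 h2).
Qed.

Lemma H1map_comp F G H (f : grp_morph G H) (g : grp_morph F G)
    (h : grp_morph F H) :
  (forall (U : opens X) (s : F U), f U (g U s) = h U s) ->
  forall a, H1map f (H1map g a) = H1map h a.
Proof.
move=> fgE; apply: H1_ind => c; rewrite !H1map_pi H1_eqP.
exists (cidx c), (@ccov _ _ c), id, id, (fun=> 1%g).
split=> [|k x|k x|k l V hk hl h1 h2] //; first exact: ccov_cover.
by rewrite !pres1 mul1g mulg1 /= fgE (Prop_irrelevance h1 h2).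
Qed.

Lemma H1map_pt F G (f : grp_morph F G) : H1map f (H1pt F) = H1pt G.
Proof.
rewrite [in LHS]/H1pt H1map_pi H1_ptP.
exists _, (fun i : cidx (triv_cocycle F) => sval i), id, (fun=> 1%g).
split=> [|k x|k l V hk hl ha]; [exact: triv_cover|exact|].
by rewrite /= pmor1 !pres1 mulg1.
Qed.

Lemma H1_trivial F : (forall (U : opens X) (s : F U), s = 1%g) ->
  forall a : H1 F, a = H1pt F.
Proof.
move=> F1; apply: H1_ind => c; rewrite H1_ptP.
exists (cidx c), (@ccov _ _ c), id, (fun=> 1%g).
split=> [|k x|k l V hk hl ha]; [exact: ccov_cover|exact|].
by rewrite (F1 _ (csec k l)) !pres1 mulg1.
Qed.

End Cech.

(** * The exact sequence of a normal subsheaf *)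

Section Quotient.
Variables (X : topologicalType) (H G : grp_presheaf X) (i : normal_sub H G).
Let Q := quot_sheaf i.
Let q := quot_morph i.

(** A section of the quotient is a family of germs, so gluing amounts to
    choosing at each point some member of the given family. *)
Lemma quot_gluing : sheaf_gluing Q.
Proof.
move=> U I W WU s cW ss.
pose k x (hx : oset U x) := cid (cW x hx).
pose f x (hx : oset U x) : qstalk i x := s (sval (k x hx)) x (svalP (k x hx)).
have fE x (hx : oset U x) j (hj : oset (W j) x) : f x hx = s j x hj.
  pose V := oin (W (sval (k x hx))) (W j).
  have := ss _ _ V (@oinl _ _ _) (@oinr _ _ _).
  move/(congr1 (fun t : qsec i V => t x (conj (svalP (k x hx)) hj))) => /= E.
  rewrite /f (Prop_irrelevance (svalP (k x hx)) (oinl (conj (svalP (k x hx)) hj))).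
  by rewrite E; congr (qfun _); exact: Prop_irrelevance.
have floc x : oset U x -> exists (V : opens X) (g : G V), oset V x /\
    forall y (hU : oset U y) (hV : oset V y), f y hU = qgerm i (LocSec hV g).
  move=> hx; have [j Wjx] := cW x hx.
  have [V [g [Vx Eg]]] := qfun_loc (s j) Wjx.
  exists (oin V (W j)), (pres G (@oinl _ _ _) g); split=> // y hU [Vy Wy].
  rewrite (fE y hU j Wy) (Eg _ _ Vy); apply/qgermP.
  apply: (@germ_eq_res _ _ _ i y (LocSec Vy g)
    (@LocSec _ _ y (oin V (W j)) (conj Vy Wy) (pres G (@oinl _ _ _) g)) _
    (@oinl _ _ _) (fun=> id) (conj Vy Wy)).
  by rewrite /= pres_id.
exists (QSec floc) => j; apply: qsec_ext => x hx /=; exact: fE.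
Qed.

Lemma quot_locality : sheaf_locality Q.
Proof.
move=> U s t E; apply: qsec_ext => x hx; have [W [h [Wx]]] := E x hx.
move/(congr1 (fun t : qsec i W => t x Wx)) => /=.
by rewrite (Prop_irrelevance (h x Wx) hx).
Qed.

Lemma quot_sub (U : opens X) (h : H U) : q U (i U h) = 1%g.
Proof.
apply: qsec_ext => x hx; apply/esym/qgermP.
have hU : U `<=` ldom (lone G x) by [].
by exists U, hU, (fun=> id), h; rewrite /= pres_id pres1 mul1g.
Qed.

Lemma quot_local_lift (U : opens X) (t : Q U) x : oset U x ->
  exists (W : opens X) (h : W `<=` U) (g : G W), oset W x /\ q W g = pres Q h t.
Proof.
move=> Ux; have [W [g [Wx Eg]]] := qfun_loc t Ux.
exists (oin U W), (@oinl _ _ _), (pres G (@oinr _ _ _) g); split=> //.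
rewrite pmor_res; apply: qsec_ext => y [Uy Wy] /=.
by rewrite -Eg; congr (qfun t); exact: Prop_irrelevance.
Qed.

Hypotheses (locG : sheaf_locality G) (glueH : sheaf_gluing H).

(** A section that dies in the quotient has its germs in H; the local sections
    of H that they come from agree on overlaps since H embeds in G. *)
Lemma quot_kernel (U : opens X) (g : G U) :
  q U g = 1%g -> exists h : H U, i U h = g.
Proof.
move=> g1.
have loc (x : {x | oset U x}) : {W : opens X & {hW : W `<=` U &
    {h : H W | oset W (sval x) /\ pres G hW g = i W h}}}.
  case: x => x Ux /=.
  have /esym/qgermP := congr1 (fun t : qsec i U => t x Ux) g1.
  case/cid => W /cid[ha /cid[hb /cid[h [Wx E]]]].
  exists W, hb, h; split=> //; move: E => /= ->.
  by rewrite pres1 mul1g.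
have [x Ux||h hE] := @glueH U _ (fun x => projT1 (loc x))
  (fun x => projT1 (projT2 (loc x))) (fun x => sval (projT2 (projT2 (loc x)))).
- exists (exist _ x Ux).
  by case: (loc _) => W [hW [h []]].
- move=> x y V hx hy; apply: (@nsub_inj _ _ _ i); rewrite !pmor_res.
  have [_ <-] := svalP (projT2 (projT2 (loc x))).
  have [_ <-] := svalP (projT2 (projT2 (loc y))).
  rewrite (pres_comp _ _ (subset_trans hx (projT1 (projT2 (loc x))))).
  by rewrite -(pres_comp (projT1 (projT2 (loc y))) hy).
exists h; apply: locG => x Ux.
have [Wx E] := svalP (projT2 (projT2 (loc (exist _ x Ux)))).
exists (projT1 (loc (exist _ x Ux))), (projT1 (projT2 (loc (exist _ x Ux)))).
by split=> //; rewrite -pmor_res hE; exact/esym.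
Qed.

(** If sections t of Q trivialise the image of c in Q, then local lifts g of t
    to G conjugate c into a cocycle with values in H.  The lifts are part of
    the conclusion: when c is trivial and t is a global section of Q, d is the
    connecting cocycle of t, and the g are needed to recover a lift of t from a
    trivialisation of d. *)
Lemma reduce_cocycle (c : cocycle G) (K : Type) (W : K -> opens X)
    (a : K -> cidx c) (t : forall k, Q (W k)) :
  open_cover W -> (forall k, W k `<=` ccov (a k)) ->
  (forall k l (V : opens X) (hk : V `<=` W k) (hl : V `<=` W l)
     (ha : V `<=` oin (ccov (a k)) (ccov (a l))),
   (pres Q hk (t k) * pres Q ha (q _ (csec (a k) (a l))) = pres Q hl (t l))%g) ->
  exists (d : cocycle H) (m : cidx d -> K) (hm : forall u, ccov u `<=` W (m u))
    (g : forall u : cidx d, G (ccov u)),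
  (forall u, q _ (g u) = pres Q (hm u) (t (m u))) /\
  (forall u v (V : opens X) (hu : V `<=` ccov u) (hv : V `<=` ccov v)
     (ha : V `<=` oin (ccov (a (m u))) (ccov (a (m v))))
     (hd : V `<=` oin (ccov u) (ccov v)),
   (pres G hu (g u) * pres G ha (csec (a (m u)) (a (m v))) =
    i V (pres H hd (csec u v)) * pres G hv (g v))%g).
Proof.
move=> cW Wa tt.
(* the patches of d are all the open sets on which some t k lifts *)
pose C := [set U : opens X | exists k (hU : U `<=` W k) (g : G U),
  q U g = pres Q hU (t k)].
have data (u : {U | C U}) : {k : K & {hU : sval u `<=` W k &
    {g : G (sval u) | q _ g = pres Q hU (t k)}}}.
  by case: u => U /= /cid[k /cid[hU /cid[g E]]]; exists k, hU, g.
pose m u := projT1 (data u).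
pose hm (u : {U | C U}) : sval u `<=` W (m u) := projT1 (projT2 (data u)).
pose g (u : {U | C U}) : G (sval u) := sval (projT2 (projT2 (data u))).
have gE u : q _ (g u) = pres Q (hm u) (t (m u)) := svalP (projT2 (projT2 (data u))).
have hc (u v : {U | C U}) :
    oin (sval u) (sval v) `<=` oin (ccov (a (m u))) (ccov (a (m v))).
  by move=> x [ux vx]; split; [exact/Wa/hm|exact/Wa/hm].
pose e (u v : {U | C U}) : G (oin (sval u) (sval v)) := (pres G (@oinl _ _ _) (g u) *
  pres G (hc u v) (csec (a (m u)) (a (m v))) * (pres G (@oinr _ _ _) (g v))^-1)%g.
have e1 u v : q _ (e u v) = 1%g.
  rewrite /e !pmorM pmorV !pmor_res !gE.
  rewrite (pres_comp _ _ (subset_trans (@oinl _ _ _) (hm u))).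
  rewrite (pres_comp _ _ (subset_trans (@oinr _ _ _) (hm v))).
  by rewrite (tt _ _ _ _ (subset_trans (@oinr _ _ _) (hm v))) mulgV.
pose d u v := sval (cid (quot_kernel (e1 u v))).
have dE u v : i _ (d u v) = e u v := svalP (cid (quot_kernel (e1 u v))).
have eE (u v : {U | C U}) (V : opens X) (hu : V `<=` sval u) (hv : V `<=` sval v)
    (ha : V `<=` oin (ccov (a (m u))) (ccov (a (m v))))
    (hd : V `<=` oin (sval u) (sval v)) :
    i V (pres H hd (d u v)) = (pres G hu (g u) *
      pres G ha (csec (a (m u)) (a (m v))) * (pres G hv (g v))^-1)%g.
  rewrite pmor_res dE /e !presM presV.
  by rewrite (pres_comp _ _ hu) (pres_comp _ _ hv) (pres_comp _ _ ha).
have Ccov : open_cover (fun u : {U | C U} => sval u).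
  move=> x; have [k Wx] := cW x.
  have [U [h [s [Ux E]]]] := quot_local_lift (t k) Wx.
  have CU : C U by exists k, h, s.
  by exists (exist _ U CU).
have dP (u v w : {U | C U}) (V : opens X)
    (huv : V `<=` oin (sval u) (sval v)) (hvw : V `<=` oin (sval v) (sval w))
    (huw : V `<=` oin (sval u) (sval w)) :
    (pres H huv (d u v) * pres H hvw (d v w) = pres H huw (d u w))%g.
  apply: (@nsub_inj _ _ _ i); rewrite pmorM.
  have hu : V `<=` sval u by move=> x /huv[].
  have hv : V `<=` sval v by move=> x /huv[].
  have hw : V `<=` sval w by move=> x /huw[].
  rewrite (eE _ _ _ hu hv (subset_trans huv (hc u v))).
  rewrite (eE _ _ _ hv hw (subset_trans hvw (hc v w))).
  rewrite (eE _ _ _ hu hw (subset_trans huw (hc u w))).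
  rewrite !mulgA mulgVK.
  by rewrite -(cocycleP (subset_trans huv (hc u v)) (subset_trans hvw (hc v w))) !mulgA.
exists (Cocycle Ccov dP), m, hm, g; split=> // u v V hu hv ha hd.
by rewrite /= (eE _ _ _ hu hv ha hd) mulgVK.
Qed.

(** Exactness at H^1(G). *)
Lemma H1_lift (a : H1 G) : H1map q a = H1pt Q -> exists b : H1 H, H1map i b = a.
Proof.
move: a; apply: H1_ind => c; rewrite H1map_pi H1_ptP.
move=> [K [W [a [t [cW Wa tt]]]]].
have [d [m [hm [g [_ gd]]]]] := @reduce_cocycle c K W a t cW Wa tt.
exists (\pi_(H1 H)%qT d); rewrite H1map_pi; apply/esym/H1_eqP.
exists (cidx d), (@ccov _ _ d), (fun u => a (m u)), id, g.
split=> [|u|u|u v V hu hv ha hd].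
- exact: ccov_cover.
- exact: subset_trans (hm u) (Wa _).
- exact.
- by rewrite (gd _ _ _ hu hv ha hd) pmor_res.
Qed.

Hypothesis glueG : sheaf_gluing G.

(** The connecting cocycle of s becomes trivial in G by construction, hence is
    trivial in H; its trivialisation corrects the local lifts of s by sections
    of H so that they glue. *)
Lemma H0_surj_of_H1_kernel :
  (forall b : H1 H, H1map i b = H1pt G -> b = H1pt H) ->
  forall s : H0 Q, exists g : H0 G, H0map q g = s.
Proof.
move=> ker s.
pose o := triv_idx G.
have [||k l V hk hl ha|d [m [hm [g [gs gd]]]]] :=
  @reduce_cocycle (triv_cocycle G) unit (fun=> ofull X) (fun=> o) (fun=> s).
- by move=> x; exists tt.
- by [].
- by rewrite [q _ _](pmor1 q) pres1 mulg1 (Prop_irrelevance hk hl).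
have /H1_ptP[L [V [b [t [cV hb ht]]]]] : \pi_(H1 H)%qT d = H1pt H.
  apply: ker; rewrite H1map_pi; apply/esym/H1_eqP.
  exists (cidx d), (@ccov _ _ d), (fun=> o), id, g.
  split=> [|u|u|u v V hu hv ha hd].
  - exact: ccov_cover.
  - exact.
  - exact.
  - by rewrite (gd _ _ _ hu hv ha hd) pmor_res.
(* the local lifts, corrected by the trivialisation t of d *)
pose f k : G (V k) := (i _ (t k) * pres G (hb k) (g (b k)))%g.
have [x _||G0 G0E] := @glueG (ofull X) L V (fun k x _ => I) f.
- exact: cV.
- move=> k l W hk hl.
  have h1 : W `<=` ccov (b k) := subset_trans hk (hb k).
  have h2 : W `<=` ccov (b l) := subset_trans hl (hb l).
  have h12 : W `<=` oin (ccov (b k)) (ccov (b l)) by move=> x Wx; split; auto.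
  have hoo : W `<=` oin (ccov o) (ccov o) by [].
  rewrite /f !presM (pres_comp _ _ h1) (pres_comp _ _ h2) -!pmor_res.
  rewrite -(ht _ _ _ hk hl h12) pmorM -mulgA; congr (_ * _)%g.
  by rewrite -(gd _ _ _ h1 h2 hoo h12) /= pres1 mulg1.
exists G0; apply: quot_locality => x _; have [k Vx] := cV x.
exists (V k), (fun x _ => I); split=> //.
rewrite /H0map -pmor_res G0E /f pmorM quot_sub mul1g pmor_res gs.
exact: pres_comp.
Qed.

(** If t trivialises c in G, the classes of the t k in Q agree on overlaps, as
    c has values in H.  They glue to a global section of Q; dividing t by a
    global lift g of that section leaves a trivialisation of c by sections of H, because
    left translation by g does not disturb the coboundary relation. *)
Lemma H1_kernel_of_H0_surj :
  (forall s : H0 Q, exists g : H0 G, H0map q g = s) ->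
  forall b : H1 H, H1map i b = H1pt G -> b = H1pt H.
Proof.
move=> surj; apply: H1_ind => c; rewrite H1map_pi !H1_ptP.
move=> [K [W [a [t [cW Wa tE]]]]].
have [x _||s sE] := @quot_gluing (ofull X) K W (fun k x _ => I)
  (fun k => q _ (t k)).
- exact: cW.
- move=> k l V hk hl; rewrite -!pmor_res.
  have ha : V `<=` oin (ccov (a k)) (ccov (a l)).
    by move=> x Vx; split; [exact/Wa/hk|exact/Wa/hl].
  rewrite -(tE _ _ _ hk hl ha) pmorM [X in (_ * X)%g](_ : _ = 1%g) ?mulg1 //.
  by rewrite pmor_res [q _ _]quot_sub pres1.
have [g gs] := surj s.
have hf k : W k `<=` ofull X by [].
have loc k : exists h, i (W k) h = ((pres G (hf k) g)^-1 * t k)%g.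
  apply: quot_kernel; rewrite pmorM pmorV pmor_res.
  move: gs; rewrite /H0map => ->.
  by rewrite (Prop_irrelevance (hf k) (fun x _ => I)) sE mulVg.
exists K, W, a, (fun k => sval (cid (loc k))); split=> // k l V hk hl ha.
apply: (@nsub_inj _ _ _ i); rewrite pmorM !pmor_res.
rewrite (svalP (cid (loc k))) (svalP (cid (loc l))) !presM !presV.
rewrite -(tE _ _ _ hk hl ha) /= -mulgA; congr (_^-1 * _)%g.
have hV : V `<=` ofull X by [].
by rewrite !(pres_comp _ _ hV).
Qed.

End Quotient.

(** * Filtration by the powers of J *)

Section Automorphisms.
Variables (R : realType) (n : nat) (M : complex_manifold R n) (r : nat).
Variable E : vector_bundle M r.
Local Notation A := (extsec E).
Implicit Types U V W : opens M.
Local Arguments efun {R n M r E U} e V h s : rename.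

Lemma esec_extres U V (h : V `<=` U) (s : A U) x (Ux : oset U x) (Vx : oset V x) :
  esec (extres h s) Vx = esec s Ux.
Proof. by rewrite /= (Prop_irrelevance (h x Vx) Ux). Qed.

Lemma graded_in_sum (P : pred nat) U (L : seq (A U * A U)) :
  (forall p, p \in L -> graded_in P (p.1 * p.2)) ->
  graded_in P (\sum_(p <- L) p.1 * p.2).
Proof.
move=> HL; rewrite big_seq; elim/big_ind: _ => // [x hx S|s t hs ht x hx S].
  by rewrite ffunE eqxx.
have -> : esec (s + t) hx S = esec s hx S + esec t hx S by rewrite [LHS]ffunE.
by have [->|/hs //] := eqVneq (esec s hx S) 0; rewrite add0r => /ht.
Qed.

Lemma powJ_graded k U (s : A U) : powJ k s -> graded_in (leq k) s.
Proof.
elim: k U s => [|k IH] U s hs x Ux; first by move=> S.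
have [W [h [L [Wx HL EL]]]] := hs x Ux.
rewrite -(esec_extres h s Ux Wx) EL; apply: graded_in_sum => p /HL[/IH h1 h2] y Wy.
by rewrite -addn1; exact: ext_inM (h1 y Wy) (h2 y Wy).
Qed.

(** The exterior powers of a bundle of rank r vanish beyond the r-th. *)
Lemma powJ_rank U (s : A U) : powJ r.+1 s -> s = 0.
Proof.
move=> /powJ_graded hs; apply: extsec_ext => x hx; apply/ffunP => S.
rewrite [RHS]ffunE; apply/eqP; apply: contraT => /(hs x hx).
have [a ax] := frame_cover E x.
rewrite [X in (X < _)%N](_ : _ = \dim {:fibre E x}).
  by rewrite ltnNge -[X in (_ <= X)%N]card_ord max_card.
exact: (esym (size_basis (frame_basis ax))).
Qed.

Lemma powJ_local k U (s : A U) :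
  (forall x, oset U x -> exists W (h : W `<=` U), oset W x /\ powJ k (extres h s)) ->
  powJ k s.
Proof.
case: k => [//|k] loc x Ux; have [W [h [Wx hs]]] := loc x Ux.
have [V [hV [L [Vx HL EL]]]] := hs x Wx.
exists V, (subset_trans hV h), L; split=> //.
by rewrite -EL (extres_comp _ _ (subset_trans hV h)).
Qed.

Lemma in_G_local k U (f : extaut E U) :
  (forall x, oset U x -> exists W (h : W `<=` U), oset W x /\ in_G k (extaut_res h f)) ->
  in_G k f.
Proof.
move=> loc V h s; apply: powJ_local => x Vx.
have [W [hW [Wx fW]]] := loc x (h x Vx).
exists (oin V W), (@oinl _ _ _); split=> //.
have := fW (oin V W) (@oinr _ _ _) (extres (@oinl _ _ _) s).
rewrite extresD extresN.
by rewrite (efun_res f h _ (subset_trans (@oinr _ _ _) hW)).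
Qed.

Lemma Gsheaf_trivial k : (r < k)%N -> forall U (f : Gsheaf E k U), f = 1%g.
Proof.
move=> rk U f; apply: sgval_inj; apply: extaut_ext => V h s.
apply/eqP; rewrite -subr_eq0; apply/eqP; apply: powJ_rank.
exact: (in_G_le rk (sgvalP f)).
Qed.

(** * Gluing automorphisms of the exterior algebra *)

(** An endomorphism of a sheaf is determined on a cover, because it commutes
    with restrictions. *)
Lemma extend_locality U (f g : extend E U) :
  (forall x, oset U x -> exists W (h : W `<=` U),
     oset W x /\ extend_res h f = extend_res h g) -> f = g.
Proof.
move=> loc; apply: extend_ext => V h s; apply: extsec_ext => x Vx.
have [W [hW [Wx fg]]] := loc x (h x Vx).
pose VW := oin V W; have VWx : oset VW x by [].
rewrite -!(esec_extres (@oinl _ V W) _ Vx VWx).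
rewrite !(efun_res _ _ _ (subset_trans (@oinr _ V W) hW)).
by have := congr1 (fun e => efun e VW (@oinr _ V W) (extres (@oinl _ V W) s)) fg => /= ->.
Qed.

Lemma extend_res_comp U V (h : V `<=` U) (f g : extend E U) :
  extend_res h (extend_comp f g) = extend_comp (extend_res h f) (extend_res h g).
Proof. exact: extend_ext. Qed.

Section Gluing.
Variables (U : opens M) (I : Type) (W : I -> opens M).
Variable e : forall i, extend E (W i).
Hypothesis cW : forall x, oset U x -> exists i, oset (W i) x.
Hypothesis ee : forall i j (V : opens M) (hi : V `<=` W i) (hj : V `<=` W j),
  extend_res hi (e i) = extend_res hj (e j).

Let idx x (Ux : oset U x) : I := sval (cid (cW Ux)).
Let idxP x (Ux : oset U x) : oset (W (idx Ux)) x := svalP (cid (cW Ux)).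

(** Endomorphisms act on sections and not on fibres, so the value at x is read
    off after restricting s to a patch, chosen separately for each x. *)
Definition glue_val V (h : V `<=` U) (s : A V) : fsec V (extfibre E) :=
  fun x Vx => let i := idx (h x Vx) in
    esec (efun (e i) (oin V (W i)) (@oinr _ _ _) (extres (@oinl _ _ _) s))
      (conj Vx (idxP (h x Vx))).

(** Independence of the chosen patch, and of the neighbourhood on which the
    local endomorphism is evaluated. *)
Lemma glue_valE V (h : V `<=` U) (s : A V) j V' (k : V' `<=` V) (l : V' `<=` W j)
    x (Vx : oset V x) (V'x : oset V' x) :
  glue_val h s Vx = esec (efun (e j) V' l (extres k s)) V'x.
Proof.
rewrite /glue_val; set i := idx _; set VWx := conj _ _.
pose T := oin V' (W i).
have Tx : oset T x by split=> //; exact: idxP.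
have TW : T `<=` oin V (W i) by move=> y [/k].
have TV' : T `<=` V' by exact: oinl.
have TWi : T `<=` W i by exact: oinr.
have TWj : T `<=` W j := subset_trans TV' l.
rewrite -(esec_extres TW _ VWx Tx) -(esec_extres TV' _ V'x Tx).
rewrite (efun_res (e i) _ _ TWi) (efun_res (e j) _ _ TWj).
rewrite !(extres_comp _ _ (subset_trans TV' k)).
by have := congr1 (fun f => efun f T (fun=> id) (extres (subset_trans TV' k) s))
  (ee TWi TWj) => /=;
  rewrite (Prop_irrelevance (subset_trans _ TWi) TWi)
    (Prop_irrelevance (subset_trans _ TWj) TWj) => ->.
Qed.

Lemma glue_val_hol V (h : V `<=` U) (s : A V) :
  glue_val h s \in ext_holomorphicb (U := V).
Proof.
apply/asboolP => x Vx; have [j Wx] := cW (h x Vx).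
pose t := efun (e j) (oin V (W j)) (@oinr _ _ _) (extres (@oinl _ _ _) s).
have /asboolP ht := esecP t.
have [T [L [Tx HL EL]]] := ht x (conj Vx Wx).
exists (oin T (W j)), L; split=> // [p /HL[h1 h2]|y Vy [Ty Wy]].
  split; first exact: holomorphic_onS (@oinl _ _ _) h1.
  by move=> v /h2; exact: holomorphic_secS (@oinl _ _ _).
rewrite -(EL y (conj Vy Wy) Ty).
exact: (glue_valE h s (@oinl _ _ _) (@oinr _ _ _)).
Qed.

Definition glue_fun V (h : V `<=` U) (s : A V) : A V := ExtSec (glue_val_hol h s).

(** Near a point the glued map is one of the given endomorphisms, for all
    sections at once; the algebraic properties follow from theirs. *)
Lemma glue_funE V (h : V `<=` U) x (Vx : oset V x) :
  exists j (V' : opens M) (k : V' `<=` V) (l : V' `<=` W j) (V'x : oset V' x),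
  forall s, esec (glue_fun h s) Vx = esec (efun (e j) V' l (extres k s)) V'x.
Proof.
have [j Wx] := cW (h x Vx).
exists j, (oin V (W j)), (@oinl _ _ _), (@oinr _ _ _), (conj Vx Wx) => s.
exact: glue_valE.
Qed.

Lemma glue_linear V (h : V `<=` U) : linear (glue_fun h).
Proof.
move=> a s t; apply: extsec_ext => x Vx.
have [j [V' [k [l [V'x fE]]]]] := glue_funE h Vx.
rewrite -[RHS]/(a *: esec (glue_fun h s) Vx + esec (glue_fun h t) Vx) !fE.
have -> : extres k (a *: s + t) = a *: extres k s + extres k t by exact: extsec_ext.
by rewrite efun_linear.
Qed.

Lemma glue_monoid V (h : V `<=` U) : GRing.monoid_morphism (glue_fun h).
Proof.
split=> [|s t]; apply: extsec_ext => x Vx;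
  have [j [V' [k [l [V'x fE]]]]] := glue_funE h Vx.
  have := fE 1; have -> : extres k 1 = 1 :> A V' by exact: extsec_ext.
  by rewrite efun1.
rewrite -[RHS]/(esec (glue_fun h s) Vx * esec (glue_fun h t) Vx) !fE.
by rewrite extresM efunM.
Qed.

Lemma glue_graded (P : pred nat) V (h : V `<=` U) (s : A V) :
  (forall j V' (l : V' `<=` W j) (t : A V'), graded_in P t ->
     graded_in P (efun (e j) V' l t)) ->
  graded_in P s -> graded_in P (glue_fun h s).
Proof.
move=> eP sP x Vx; have [j [V' [k [l [V'x ->]]]]] := glue_funE h Vx.
by apply: eP => y V'y; exact: sP.
Qed.

Lemma glue_res V V' (h : V `<=` U) (k : V' `<=` V) (l : V' `<=` U) (s : A V) :
  extres k (glue_fun h s) = glue_fun l (extres k s).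
Proof.
apply: extsec_ext => x V'x; have [j [T [m [o [Tx ->]]]]] := glue_funE l V'x.
rewrite (extres_comp _ _ (subset_trans m k)).
exact: glue_valE.
Qed.

Definition glue_extend : extend E U :=
  ExtEnd glue_linear glue_monoid
    (fun V h s => @glue_graded (fun j => ~~ odd j) V h s
      (fun j => @efun_even _ _ _ _ _ _ (e j)))
    (fun V h s => @glue_graded odd V h s
      (fun j => @efun_odd _ _ _ _ _ _ (e j)))
    glue_res.

Lemma glue_extendE i (WU : W i `<=` U) : extend_res WU glue_extend = e i.
Proof.
apply: extend_ext => V h s; apply: extsec_ext => x Vx /=.
rewrite (glue_valE _ _ (fun=> id) h Vx Vx).
by have -> : extres (fun=> id) s = s by exact: extsec_ext.
Qed.

End Gluing.

Lemma Aut_sheaf_locality : sheaf_locality (Aut_sheaf E).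
Proof.
move=> U f g loc.
have fg : afun f = afun g.
  apply: extend_locality => x Ux; have [W [h [Wx fg]]] := loc x Ux.
  by exists W, h; split=> //; have := congr1 (@afun _ _ _ _ _ _) fg.
by apply: extaut_ext => V h s; rewrite fg.
Qed.

(** The inverses of compatible automorphisms are compatible too, and glue to an
    inverse of the glued endomorphism. *)
Lemma Aut_sheaf_gluing : sheaf_gluing (Aut_sheaf E).
Proof.
move=> U I W WU s cW ss.
have ss1 i j (V : opens M) (hi : V `<=` W i) (hj : V `<=` W j) :
    extend_res hi (s i) = extend_res hj (s j).
  by have := congr1 (@afun _ _ _ _ _ _) (ss i j V hi hj).
have ss2 i j (V : opens M) (hi : V `<=` W i) (hj : V `<=` W j) :
    extend_res hi (ainv (s i)) = extend_res hj (ainv (s j)).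
  by have := congr1 (@ainv _ _ _ _ _ _) (ss i j V hi hj).
pose f := glue_extend cW ss1; pose g := glue_extend cW ss2.
have fE i := glue_extendE cW ss1 (WU i); have gE i := glue_extendE cW ss2 (WU i).
have gf : extend_comp g f = extend_id E U.
  apply: extend_locality => x Ux; have [i Wx] := cW x Ux.
  exists (W i), (WU i); split=> //.
  rewrite extend_res_comp fE gE afunK; exact: extend_ext.
have fg : extend_comp f g = extend_id E U.
  apply: extend_locality => x Ux; have [i Wx] := cW x Ux.
  exists (W i), (WU i); split=> //.
  rewrite extend_res_comp fE gE ainvK; exact: extend_ext.
exists (ExtAut gf fg) => i; apply: extaut_ext => V h t.
by have := congr1 (fun e => efun e V h t) (fE i).
Qed.

Lemma Gsheaf_locality k : sheaf_locality (Gsheaf E k).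
Proof.
move=> U f g loc; apply: sgval_inj; apply: Aut_sheaf_locality => x Ux.
have [W [h [Wx fg]]] := loc x Ux; exists W, h; split=> //.
exact: (congr1 (@sgval _ _ _ _) fg).
Qed.

Lemma Gsheaf_gluing k : sheaf_gluing (Gsheaf E k).
Proof.
move=> U I W WU s cW ss.
have [|i j V hi hj|f fE] := @Aut_sheaf_gluing U I W WU (fun i => sgval (s i)).
- exact: cW.
- exact: (congr1 (@sgval _ _ _ _) (ss i j V hi hj)).
have fG : in_G k f.
  apply: in_G_local => x Ux; have [i Wx] := cW x Ux.
  exists (W i), (WU i); split=> //.
  have := sgvalP (s i); by rewrite -fE.
by exists (SGSec (P := Gsub E k) fG) => i; apply: sgval_inj; exact: fE.
Qed.

(** * Good models *)

Lemma H1_Gincl_comp k l (k2 : (2 <= k)%N) (l2 : (2 <= l)%N) (kl : (k <= l)%N)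
    (b : H1 (Gsheaf E l)) :
  H1map (Gincl E k2) (H1map (Gincl E kl) b) = H1map (Gincl E l2) b.
Proof. by apply: H1map_comp => U s; exact: sgval_inj. Qed.

(** Downward induction on k, starting beyond the rank of E, where G^(k) is
    trivial: an atlas that is strongly split is unobstructed, so it lifts to a
    strongly split atlas of the next level. *)
Lemma good_kernel_trivial : good_model E ->
  forall k (k2 : (2 <= k)%N) (a : split_atlas E k),
    associated_supermanifold k2 a = H1pt (Gsheaf E 2) -> a = H1pt (Gsheaf E k).
Proof.
move=> good k; have [d] := ubnP (r.+1 - k).
elim: d k => // d IH k dk k2 a a1.
have [rk|kr] := ltnP r k; first exact: H1_trivial (Gsheaf_trivial rk) a.
have := k2; rewrite leq_eqVlt => /orP[/eqP k1|k3].
  subst k; rewrite -a1; apply/esym.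
  by apply: H1map_id => U s; exact: sgval_inj.
have /(H1_lift (@Gsheaf_locality k) (@Gsheaf_gluing k.+1))[b ba] :
    H1map (Gquot E k) a = H1pt (Qsheaf E k).
  apply: contrapT => obs; apply: (good (H1pt (Gsheaf E 2)) k k3).
  rewrite (Prop_irrelevance k2 (ltnW k3)) in a1.
  by exists a; split=> //; split.
suff b1 : b = H1pt (Gsheaf E k.+1) by rewrite -ba b1 H1map_pt.
apply: (IH k.+1 _ (ltnW (ltnW k3) : (2 <= k.+1)%N)); first by rewrite subSS -ltnS -subSn.
by rewrite /associated_supermanifold -(H1_Gincl_comp k2 _ (leqnSn k)) [H1map _ b]ba.
Qed.

(** By induction on k a strongly split atlas is the basepoint: its image one
    level down is strongly split. *)
Lemma good_of_H0_surj :
  (forall k, (2 <= k)%N ->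
     forall s : H0 (Qsheaf E k), exists g, H0map (Gquot E k) g = s) ->
  good_model E.
Proof.
move=> surj S k k2 [a [_ [obs a1]]]; apply: obs.
suff -> : a = H1pt (Gsheaf E k) by exact: H1map_pt.
elim: k k2 a a1 => // k IH k2 a a1.
apply: (H1_kernel_of_H0_surj (@Gsheaf_locality k) (@Gsheaf_gluing k.+1) (surj k k2)).
have := k2; rewrite leq_eqVlt => /orP[/eqP[k1]|k3].
  subst k; rewrite -a1.
  by rewrite /associated_supermanifold (Prop_irrelevance (ltnW k2) (leqnSn 2)).
apply: (IH k3).
by rewrite /strongly_split -[RHS]a1; exact: H1_Gincl_comp.
Qed.

End Automorphisms.

Theorem theorem4p3 (R : realType) (n : nat) (M : complex_manifold R n)
    (r : nat) (E : vector_bundle M r) :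
  good_model E <->
  (forall k : nat, (2 <= k)%N ->
     short_exact (H0map (Gincl E (leqnSn k))) (H0map (Gquot E k))).
Proof.
split=> [good k k2|exact_k].
  split=> [f|f|].
  - split=> [f1|->]; last exact: pmor1.
    by apply: (@nsub_inj _ _ _ (Gnormal E k)); rewrite pmor1.
  - split=> [f1|[g <-]]; last exact: (quot_sub (Gnormal E k)).
    exact: (quot_kernel (@Gsheaf_locality _ _ _ _ E k)
      (@Gsheaf_gluing _ _ _ _ E k.+1) f1).
  - apply: (H0_surj_of_H1_kernel (@Gsheaf_locality _ _ _ _ E k)
      (@Gsheaf_gluing _ _ _ _ E k.+1) (@Gsheaf_gluing _ _ _ _ E k)) => b b1.
    apply: (good_kernel_trivial good (k2 := leqW k2)).
    rewrite /associated_supermanifold -(H1_Gincl_comp k2 _ (leqnSn k)).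
    by rewrite [H1map _ b]b1 H1map_pt.
by apply: good_of_H0_surj => k /exact_k[].
Qed.
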